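(* Let $\mathcal{M}=(M,<,\ldots)$ be an o-minimal structure, let $p(x)\in S(M)$ be a type and let $\varphi(x,y)$ be a formula. Then there exists another formula $\psi(x,z)$ such that $p|^1_\psi(x)$ is downward directed and \[ p|^1_\psi \vdash p|_\varphi . \] In particular, for every finite subtype $q\subseteq p|_\varphi$, there exists $c\in M^{|z|}$ such that $\psi(x,c)\in p(x)$ and $\psi(x,c)\vdash q(x)$.
   Context: $\mathcal{M}$ expands a dense linear order without endpoints. Formulas may have parameters from $M$; variables $x,y,z$ are finite tuples, $|z|$ denoting length. $S(M)$ is the set of complete (consistent) types over $M$ in finitely many variables. For a type $p(x)$ and formula $\varphi(x,y)$: $p|_\varphi(x)$ is the set of all formulas $\varphi(x,b)$ or $\neg\varphi(x,b)$, $b\in M^{|y|}$, that belong to $p(x)$; and $p|^1_\varphi(x)=\{\varphi(x,b)\in p(x): b\in M^{|y|}\}$. For formulas, $\varphi(x)\vdash\psi(x)$ means $\mathcal{M}\models\forall x(\varphi(x)\to\psi(x))$. For sets of formulas, $p(x)\vdash q(x)$ means that for every $\varphi(x)\in q(x)$ there is a finite $p'\subseteq p$ with $\bigwedge p'(x)\vdash\varphi(x)$ (and $\psi(x,c)\vdash q(x)$ means $\{\psi(x,c)\}\vdash q(x)$). A set of formulas is downward directed if any two of its members are both implied (in the sense of $\vdash$) by a single member; equivalently the family of sets they define is downward directed under inclusion. *)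

(* Defs.v *)
From mathcomp Require Import all_boot all_order.
From mathcomp Require Import boolp classical_sets cardinality.
From mathcomp Require Import interval.

Set Implicit Arguments.
Unset Strict Implicit.
Unset Printing Implicit Defensive.

Local Open Scope classical_set_scope.

(* First-order languages containing a binary relation symbol [<]: a
   [signature] lists the symbols other than [<] and equality, which are
   primitive in [formula]. *)
Record signature := Signature {
  fsym : Type;
  farity : fsym -> nat;
  rsym : Type;
  rarity : rsym -> nat
}.

(* [term L M V] and [formula L M V] are the terms and formulas of [L] with
   parameters from [M] and free variables in [V].  The quantifier [Ex] binds
   the variable [None] of [option V]. *)
Inductive term (L : signature) (M V : Type) : Type :=
| Var (v : V)
| Par (a : M)
| App (f : fsym L) (ts : 'I_(farity f) -> term L M V).

Arguments Var {L M V} v.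
Arguments Par {L M V} a.
Arguments App {L M V} f ts.

Inductive formula (L : signature) (M V : Type) : Type :=
| Eq (t u : term L M V)
| Lt (t u : term L M V)
| Rel (r : rsym L) (ts : 'I_(rarity r) -> term L M V)
| Neg (f : formula L M V)
| And (f g : formula L M V)
| Ex (f : formula L M (option V)).

Arguments Eq {L M V} t u.
Arguments Lt {L M V} t u.
Arguments Rel {L M V} r ts.
Arguments Neg {L M V} f.
Arguments And {L M V} f g.
Arguments Ex {L M V} f.

Fixpoint tsubst (L : signature) (M V W : Type) (s : V -> term L M W)
    (t : term L M V) : term L M W :=
  match t with
  | Var v => s v
  | Par a => Par a
  | App f ts => App f (fun i => tsubst s (ts i))
  end.

Definition up (L : signature) (M V W : Type) (s : V -> term L M W)
    (o : option V) : term L M (option W) :=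
  if o is Some v then tsubst (fun w => Var (Some w)) (s v) else Var None.

Fixpoint fsubst (L : signature) (M V W : Type) (s : V -> term L M W)
    (f : formula L M V) : formula L M W :=
  match f with
  | Eq t u => Eq (tsubst s t) (tsubst s u)
  | Lt t u => Lt (tsubst s t) (tsubst s u)
  | Rel r ts => Rel r (fun i => tsubst s (ts i))
  | Neg f => Neg (fsubst s f)
  | And f g => And (fsubst s f) (fsubst s g)
  | Ex f => Ex (fsubst (up s) f)
  end.

(* The formula phi(x, b), for phi(x, y) with |x| = n and |y| = m. *)
Definition inst (L : signature) (M : Type) (n m : nat)
    (phi : formula L M ('I_n + 'I_m)) (b : 'I_m -> M) : formula L M 'I_n :=
  fsubst (fun v => match v with inl i => Var i | inr j => Par (b j) end) phi.

(* An expansion of the ordered set [M] to a structure for [L] and [<]. *)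
Record structure (L : signature) d (M : orderType d) := Structure {
  fint : forall f : fsym L, ('I_(farity f) -> M) -> M;
  rint : forall r : rsym L, ('I_(rarity r) -> M) -> Prop
}.

Section Semantics.
Variables (L : signature) (d : Order.disp_t) (M : orderType d).
Variable S : structure L M.

Fixpoint teval (V : Type) (e : V -> M) (t : term L M V) : M :=
  match t with
  | Var v => e v
  | Par a => a
  | App f ts => fint S (fun i => teval e (ts i))
  end.

Fixpoint sat (V : Type) (f : formula L M V) (e : V -> M) : Prop :=
  match f with
  | Eq t u => teval e t = teval e u
  | Lt t u => (teval e t < teval e u)%O
  | Rel r ts => rint S (fun i => teval e (ts i))
  | Neg f => ~ sat f e
  | And f g => sat f e /\ sat g e
  | Ex f => exists a : M, sat f (oapp e a)
  end.

(* The intervals of MathComp may be open, closed, half-open or unbounded on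
   each side, with endpoints in [M]; points are the intervals `[a, a]. *)
Definition o_minimal : Prop :=
  [/\ inhabited M,
      forall a b : M, (a < b)%O -> exists c : M, (a < c < b)%O,
      forall a : M, exists b c : M, (b < a < c)%O
    & forall phi : formula L M 'I_1, exists s : seq (interval M),
        forall a : M, sat phi (fun=> a) <-> exists2 I, I \in s & a \in I].

Section Types.
Variable n : nat.
Implicit Types (p q : set (formula L M 'I_n)) (phi psi : formula L M 'I_n).

Definition fentails phi psi : Prop :=
  forall a : 'I_n -> M, sat phi a -> sat psi a.

Definition entails p q : Prop :=
  forall phi, q phi -> exists p', [/\ finite_set p', p' `<=` p
    & forall a : 'I_n -> M, (forall chi, p' chi -> sat chi a) -> sat phi a].

Definition downward_directed p : Prop :=
  forall phi psi, p phi -> p psi ->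
    exists chi, [/\ p chi, fentails chi phi & fentails chi psi].

(* Consistency is relative to the elementary diagram of the structure, i.e.
   finite satisfiability in it. *)
Definition consistent p : Prop :=
  forall q, finite_set q -> q `<=` p ->
    exists a : 'I_n -> M, forall phi, q phi -> sat phi a.

Definition complete_type p : Prop :=
  consistent p /\ forall phi, p phi \/ p (Neg phi).

End Types.
End Semantics.

Definition restr (L : signature) (M : Type) (n m : nat)
    (p : set (formula L M 'I_n)) (phi : formula L M ('I_n + 'I_m)) :
    set (formula L M 'I_n) :=
  [set chi | p chi /\
    exists b : 'I_m -> M, chi = inst phi b \/ chi = Neg (inst phi b)].

Definition restr1 (L : signature) (M : Type) (n m : nat)
    (p : set (formula L M 'I_n)) (phi : formula L M ('I_n + 'I_m)) :
    set (formula L M 'I_n) :=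
  [set chi | p chi /\ exists b : 'I_m -> M, chi = inst phi b].

(* Main.v *)
Require Import Defs.
From mathcomp Require Import all_boot all_order.
From mathcomp Require Import boolp classical_sets cardinality filter.
From mathcomp Require Import interval.

(* Call a set definable if a formula with parameters defines it, and replace [p]
   by an ultrafilter on [M^n], so that membership in [p] is membership in the
   ultrafilter. The proof is by induction on [n]: split a tuple into its first
   coordinate [t] and the rest [s]. By uniform finiteness the fibers of [phi] over
   [(s, b)] have at most [K] frontier points, so [t] lies in one of boundedly many
   cells, each cut out by sets upward closed in [t] (those with at least [i]
   frontier points below [t]). Upward closed sets are comparable in each fiber, and
   which inclusion holds is a condition on [s] alone, to be decided by the base
   given by the induction hypothesis.

   Uniform finiteness is proved without cell decomposition. A definable function
   of one variable is continuous on some interval to the right of any point; hence,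
   for a planar set with finite columns, the size of the columns is locally constant
   off a finite set given by a formula. In more variables take an ultrafilter
   containing all the sets where the fibers have at least [k] points. If it has a
   member that is finite along some coordinate direction, project that direction
   out; otherwise the size of the fibers is locally constant in each coordinate
   direction on some member, and it descends to fewer variables. *)

Set Implicit Arguments.
Unset Strict Implicit.
Unset Printing Implicit Defensive.

Import Order.TTheory.
Local Open Scope classical_set_scope.

(** * Definable sets *)

Section Substitution.
Variables (L : signature) (d : Order.disp_t) (M : orderType d).
Variable S : structure L M.

Lemma teval_tsubst V W (s : V -> term L M W) t e :
  teval S e (tsubst s t) = teval S (fun v => teval S e (s v)) t.
Proof.
elim: t => //= f ts IH; congr (fint _ _); apply: funext => i; exact: IH.
Qed.

Lemma sat_fsubst V W (s : V -> term L M W) f e :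
  sat S (fsubst s f) e <-> sat S f (fun v => teval S e (s v)).
Proof.
elim: f W s e => [V' t u|V' t u|V' r ts|V' f IH|V' f IHf g IHg|V' f IH] W s e /=.
- by rewrite !teval_tsubst.
- by rewrite !teval_tsubst.
- by rewrite (_ : (fun i => _) = (fun i => teval S (fun v => teval S e (s v)) (ts i))) //;
     apply: funext => i; rewrite teval_tsubst.
- by rewrite IH.
- by rewrite IHf IHg.
- have E a : (fun v => teval S (oapp e a) (up s v)) =
      oapp (fun v => teval S e (s v)) a.
    by apply: funext => -[v|] //=; rewrite teval_tsubst.
  by split=> -[a h]; exists a; move: h; rewrite IH E.
Qed.

Lemma sat_inst n m (phi : formula L M ('I_n + 'I_m)) b a :
  sat S (inst phi b) a <->
  sat S phi (fun v => match v with inl i => a i | inr j => b j end).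
Proof.
rewrite sat_fsubst (_ : (fun v => _) =
  (fun v => match v with inl i => a i | inr j => b j end)) //.
by apply: funext => -[].
Qed.

End Substitution.

Section Definable.
Variables (L : signature) (d : Order.disp_t) (M : orderType d).
Variable S : structure L M.

Definition dfn (V : Type) (P : (V -> M) -> Prop) : Prop :=
  exists f : formula L M V, forall e, P e <-> sat S f e.

Definition tm (V : Type) (x : (V -> M) -> M) : Prop :=
  exists t : term L M V, forall e, x e = teval S e t.

(** A function counts as definable when its graph is, since functions chosen by a definable
    condition need not be values of terms. *)
Definition dft (V : Type) (x : (V -> M) -> M) : Prop :=
  dfn (fun e : option V -> M => x (fun v => e (Some v)) = e None).

Definition dfn1 (A : M -> Prop) : Prop :=
  dfn (fun e : unit -> M => A (e tt)).

Definition dfn2 (R : M -> M -> Prop) : Prop :=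
  dfn (fun e : bool -> M => R (e true) (e false)).

Definition dff (f : M -> M) : Prop := dfn2 (fun x y => f x = y).

(** The distinguished variable sits at [None], where [Ex] binds, so that a definable family of
    subsets of the line can be quantified directly. *)
Definition dfnR (X : Type) (R : (X -> M) -> M -> Prop) : Prop :=
  dfn (fun e : option X -> M => R (fun v => e (Some v)) (e None)).

Lemma dfn_ext V (P Q : (V -> M) -> Prop) :
  (forall e, P e <-> Q e) -> dfn P -> dfn Q.
Proof. by move=> PQ [f fP]; exists f => e; rewrite -PQ. Qed.

Lemma dfn_not V (P : (V -> M) -> Prop) : dfn P -> dfn (fun e => ~ P e).
Proof. by move=> [f fP]; exists (Neg f) => e /=; rewrite fP. Qed.

Lemma dfn_and V (P Q : (V -> M) -> Prop) :
  dfn P -> dfn Q -> dfn (fun e => P e /\ Q e).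
Proof. by move=> [f fP] [g gQ]; exists (And f g) => e /=; rewrite fP gQ. Qed.

Lemma dfn_or V (P Q : (V -> M) -> Prop) :
  dfn P -> dfn Q -> dfn (fun e => P e \/ Q e).
Proof.
move=> hP hQ; have := dfn_not (dfn_and (dfn_not hP) (dfn_not hQ)).
apply: dfn_ext => e; split; last by tauto.
by move=> h; apply: contrapT; tauto.
Qed.

Lemma dfn_and3 V (P Q R : (V -> M) -> Prop) :
  dfn P -> dfn Q -> dfn R -> dfn (fun e => [/\ P e, Q e & R e]).
Proof.
move=> hP hQ hR; apply: dfn_ext (dfn_and hP (dfn_and hQ hR)).
by move=> e; split=> [[? []]|[]].
Qed.

Lemma dfn_imp V (P Q : (V -> M) -> Prop) :
  dfn P -> dfn Q -> dfn (fun e => P e -> Q e).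
Proof.
move=> hP hQ; have := dfn_not (dfn_and hP (dfn_not hQ)).
by apply: dfn_ext => e; split=> h; [move=> p; apply: contrapT; tauto|tauto].
Qed.

Lemma dfn_iff V (P Q : (V -> M) -> Prop) :
  dfn P -> dfn Q -> dfn (fun e => P e <-> Q e).
Proof. by move=> hP hQ; apply: dfn_and; apply: dfn_imp. Qed.

Lemma dfn_ex V (P : (V -> M) -> M -> Prop) :
  dfnR P -> dfn (fun e => exists a, P e a).
Proof.
move=> [f fP]; exists (Ex f) => e /=.
by split=> -[a h]; exists a; apply/(fP (oapp e a)).
Qed.

Lemma dfn_all V (P : (V -> M) -> M -> Prop) :
  dfnR P -> dfn (fun e => forall a, P e a).
Proof.
move=> hP.
have : dfn (fun e => ~ exists a, ~ P e a) by apply/dfn_not/dfn_ex/dfn_not.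
by apply: dfn_ext => e; rewrite -forallNE; split=> h a;
  [apply: contrapT; exact: h|move=> n; exact: n].
Qed.

Lemma dfn_cst V (P : Prop) : dfn (fun _ : V -> M => P).
Proof.
(* The syntax has no truth constants; [t] is unsatisfiable and serves as falsity. *)
pose t : formula L M V := Ex (Neg (Eq (Var None) (Var None))).
have tF e : ~ sat S t e by move=> [a /=].
by have [p|np] := pselect P; [exists (Neg t)|exists t] => e /=; split=> //;
  [move=> _; exact: tF|move/tF].
Qed.

Lemma dfn_subst V W (P : (V -> M) -> Prop) (x : V -> (W -> M) -> M) :
  dfn P -> (forall v, tm (x v)) -> dfn (fun e => P (fun v => x v e)).
Proof.
move=> [f fP] /choice[s hs]; exists (fsubst s f) => e.
rewrite sat_fsubst fP (_ : (fun v => teval S e (s v)) = (fun v => x v e)) //.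
by apply: funext => v; rewrite hs.
Qed.

Lemma tm_var V (v : V) : tm (fun e => e v).
Proof. by exists (Var v). Qed.

Lemma tm_cst V a : tm (fun _ : V -> M => a).
Proof. by exists (Par a). Qed.

Lemma tm_wk V (x : (V -> M) -> M) :
  tm x -> tm (fun e : option V -> M => x (fun v => e (Some v))).
Proof.
move=> [t ht]; exists (tsubst (fun v => Var (Some v)) t) => e.
by rewrite ht teval_tsubst.
Qed.

Lemma dft_tm V (x : (V -> M) -> M) : tm x -> dft x.
Proof.
move=> /tm_wk[t ht]; exists (Eq t (Var None)) => e /=.
by rewrite ht.
Qed.

Lemma dft_var V (v : V) : dft (fun e => e v).
Proof. exact/dft_tm/tm_var. Qed.

Lemma dft_cst V a : dft (fun _ : V -> M => a).
Proof. exact/dft_tm/tm_cst. Qed.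

Lemma dft_wk V (x : (V -> M) -> M) :
  dft x -> dft (fun e : option V -> M => x (fun v => e (Some v))).
Proof.
move=> hx.
exact: (dfn_subst (x := fun (o : option V) (e : option (option V) -> M) =>
   e (if o is Some v then Some (Some v) else None)) hx (fun o => tm_var _)).
Qed.

Lemma dfn_rel1 A V (x : (V -> M) -> M) :
  dfn1 A -> dft x -> dfn (fun e => A (x e)).
Proof.
move=> hA hx.
have : dfn (fun e => exists a, x e = a /\ A a).
  apply/dfn_ex/dfn_and => //.
  exact: (dfn_subst (x := fun _ (e : option V -> M) => e None) hA
    (fun=> tm_var _)).
by apply: dfn_ext => e; split=> [[a [<-]]|h] //; exists (x e).
Qed.

Lemma dfn_rel2 R V (x y : (V -> M) -> M) :
  dfn2 R -> dft x -> dft y -> dfn (fun e => R (x e) (y e)).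
Proof.
move=> hR hx hy.
have : dfn (fun e => exists a, x e = a /\ exists b, y e = b /\ R a b).
  apply/dfn_ex/dfn_and => //; apply/dfn_ex/dfn_and => /=.
    exact: (dft_wk hy).
  exact: (dfn_subst (x := fun (b : bool) (e : option (option V) -> M) =>
    if b then e (Some None) else e None) hR
    (fun b => match b with true => tm_var _ | false => tm_var _ end)).
apply: dfn_ext => e; split=> [[a [<- [b [<-]]]] //|h].
by exists (x e); split=> //; exists (y e).
Qed.

Lemma dfn_eq V (x y : (V -> M) -> M) :
  dft x -> dft y -> dfn (fun e => x e = y e).
Proof. by apply: (dfn_rel2 (R := eq)); exists (Eq (Var true) (Var false)). Qed.

Lemma dft_fun f V (x : (V -> M) -> M) :
  dff f -> dft x -> dft (fun e => f (x e)).
Proof. 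
move=> hf hx.
exact: (dfn_rel2 (R := fun x y => f x = y) hf (dft_wk hx) (dft_var _)).
Qed.

Lemma dfn_fam X (R : (X -> M) -> M -> Prop) V (x : X -> (V -> M) -> M)
    (y : (V -> M) -> M) :
  dfnR R -> (forall v, tm (x v)) -> dft y ->
  dfn (fun e => R (fun v => x v e) (y e)).
Proof.
move=> hR hx hy.
have : dfn (fun e => exists a, y e = a /\ R (fun v => x v e) a).
  apply/dfn_ex/dfn_and => //.
  apply: (dfn_subst (x := fun (o : option X) (e : option V -> M) =>
    if o is Some w then x w (fun v => e (Some v)) else e None) hR).
  by case=> [w|]; [exact: tm_wk|exact: tm_var].
by apply: dfn_ext => e; split=> [[a [<-]]|h] //; exists (y e).
Qed.

(** Where nothing is related to [x] the selected value is [x] itself, a default that makes the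
    function total and keeps its graph definable. *)
Lemma dff_sel R : dfn2 R -> (forall x y y', R x y -> R x y' -> y = y') ->
  exists f, dff f /\ forall x y, R x y -> R x (f x).
Proof.
move=> hR Runiq.
have /choice[f hf] x : exists y, R x y \/ (forall y, ~ R x y) /\ y = x.
  have [[y h]|h] := pselect (exists y, R x y); first by exists y; left.
  by exists x; right; split=> // y hy; apply: h; exists y.
exists f; split.
  have : dfn2 (fun x y => R x y \/ (forall y, ~ R x y) /\ y = x).
    apply: dfn_or => //; apply: dfn_and; last by apply: dfn_eq; exact: dft_var.
    by apply/dfn_all/dfn_not/dfn_rel2 => //; exact: dft_var.
  apply: dfn_ext => e; split; last by move=> <-; exact: hf.
  have [h|[h h']] := hf (e true).
    by case=> [|[nR]]; [exact: Runiq|have := nR _ h].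
  by rewrite h'; case=> [/h|[]].
by move=> x y Rxy; have [//|[/(_ _ Rxy)]] := hf x.
Qed.

Lemma dfn_leq_all V (P : nat -> (V -> M) -> Prop) K : (forall j, dfn (P j)) ->
  dfn (fun e => forall j, (j <= K)%N -> P j e).
Proof.
move=> hP; elim: K => [|K IH].
  apply: dfn_ext (hP 0%N) => e; split=> [h j|h]; last exact: h.
  by rewrite leqn0 => /eqP->.
apply: dfn_ext (dfn_and IH (hP K.+1)) => e; split=> [[h1 h2] j|h].
  by rewrite leq_eqVlt => /orP[/eqP->|] //; exact: h1.
by split=> [j jK|]; apply: h => //; exact: leqW.
Qed.

(** For a strict order, picking the points in decreasing order makes them distinct and gives a
    first-order condition for each [k]. *)
Fixpoint atleast (lt : M -> M -> Prop) (k : nat) (A : M -> Prop) : Prop :=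
  if k is k'.+1 then exists t, A t /\ atleast lt k' (fun t' => A t' /\ lt t' t)
  else True.

Lemma dfn_atleast lt k X (R : (X -> M) -> M -> Prop) :
  dfn2 lt -> dfnR R -> dfn (fun e => atleast lt k (R e)).
Proof.
move=> hlt; elim: k X R => [|k IH] X R hR /=; first exact: dfn_cst.
apply/dfn_ex/dfn_and => //.
apply: (IH _ (fun (e : option X -> M) t =>
  R (fun v => e (Some v)) t /\ lt t (e None))).
apply: dfn_and; last by apply: dfn_rel2 => //; exact: dft_var.
by apply: (dfn_fam hR) => [v|]; [exact: tm_var|exact: dft_var].
Qed.

End Definable.

Ltac dfn_step :=
  first
  [ assumption
  | apply: tm_var | apply: tm_cst
  | apply: dft_var | apply: dft_cst
  | match goal with
    | hf : dff _ ?f |- dft _ (fun e => ?f _) => apply: (dft_fun hf)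
    | hA : dfn1 _ ?A |- dfn _ (fun e => ?A _) => apply: (dfn_rel1 hA)
    | hR : dfn2 _ ?R |- dfn _ (fun e => ?R _ _) => apply: (dfn_rel2 hR)
    | hR : dfnR _ ?R |- dfn _ (fun e => ?R _ _) => apply: (dfn_fam hR) => [?|]
    end
  | apply: dfn_leq_all => ?
  | apply: dfn_atleast
  | apply: dfn_cst
  | apply: dfn_eq
  | apply: dfn_and | apply: dfn_and3 | apply: dfn_or | apply: dfn_iff
  | apply: dfn_ex; rewrite /dfnR; cbv beta
  | apply: dfn_all; rewrite /dfnR; cbv beta
  | apply: dfn_imp
  | apply: dfn_not ].
Ltac dfn_tac := rewrite ?/dfn1 ?/dfn2 ?/dfnR ?/dff; repeat (cbv beta; dfn_step).

(** * Definable subsets of the line *)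

Section Orders.
Variables (L : signature) (d : Order.disp_t) (M : orderType d).
Variable S : structure L M.

(** The order is abstract so that each one-sided result yields its mirror image through
    [flip_order]. Tameness says that membership in a definable set can change only across a point of
    a finite list. *)
Record omin_order (lt : M -> M -> Prop) : Prop := OminOrder {
  oo_irr : forall x, ~ lt x x;
  oo_trans : forall x y z, lt x y -> lt y z -> lt x z;
  oo_total : forall x y, [\/ lt x y, x = y | lt y x];
  oo_dense : forall x y, lt x y -> exists z, lt x z /\ lt z y;
  oo_lo : forall x, exists y, lt y x;
  oo_hi : forall x, exists y, lt x y;
  oo_dfn : dfn2 S lt;
  oo_tame : forall A, dfn1 S A -> exists E : seq M, forall x y, lt x y ->
    (forall e, e \in E -> lt e x \/ lt y e) -> (A x <-> A y)
}.

Lemma flip_order lt : omin_order lt -> omin_order (fun x y => lt y x).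
Proof.
case=> irr tr tot dn lo hi df tm; split=> //.
- by move=> x y z h1 h2; apply: tr h2 h1.
- by move=> x y; case: (tot x y) => ?; [constructor 3|constructor 2|constructor 1].
- by move=> x y /dn[z [? ?]]; exists z.
- by dfn_tac.
- move=> A /tm[E hE]; exists E => x y xy h.
  have := hE _ _ xy; case; last by split.
  by move=> e /h[]; [right|left].
Qed.

Lemma oo_lt_le_trans lt x y z : omin_order lt -> lt x y -> ~ lt z y -> lt x z.
Proof.
move=> O xy zy; case: (oo_total O z y) => // [->//|yz].
exact: oo_trans O _ _ _ xy yz.
Qed.

End Orders.

Ltac ord_split :=
  repeat match goal with
  | H : _ /\ _ |- _ => destruct H
  | H : [/\ _, _ & _] |- _ => destruct H
  | H : ~ ~ _ |- _ => apply: H; intro H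
  | H : ~ (_ /\ _) |- _ => apply not_andP in H
  | H : ~ (_ \/ _) |- _ => apply not_orP in H
  | H : _ \/ _ |- _ => destruct H
  | O : omin_order _ ?l, H : ?x <> ?y |- _ =>
      let h := fresh in
      assert (h := oo_total O x y);
      destruct h as [h|h|h]; [|exfalso; exact (H h)|]; clear H
  end.
Ltac ord_sat :=
  subst;
  repeat match goal with
  | O : omin_order _ ?l, H : _ = _ :> ?T |- _ =>
      lazymatch type of l with T -> _ => idtac end;
      try rewrite -> H in * |-; clear H
  end;
  repeat match goal with
  | O : omin_order _ ?l, H : ?l ?x ?x |- _ => exfalso; exact (oo_irr O H)
  | O : omin_order _ ?l, H1 : ?l ?x ?y, H2 : ?l ?y ?z |- _ =>
      lazymatch goal with
      | _ : l x z |- _ => fail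
      | _ => let h := fresh in assert (h := oo_trans O H1 H2)
      end
  | O : omin_order _ ?l, H1 : ?l ?x ?y, H2 : ~ ?l ?z ?y |- _ =>
      lazymatch goal with
      | _ : l x z |- _ => fail
      | _ => let h := fresh in assert (h := oo_lt_le_trans O H1 H2)
      end
  end.
(* Linear-order reasoning, with [x <= y] written [~ lt y x]. *)
Ltac ord := cbv beta in *; intros; apply: contrapT; intro; ord_split; ord_sat; fail.

(** * One-sided germs, definable completeness and connectedness *)

Section Germs.
Variables (L : signature) (d : Order.disp_t) (M : orderType d).
Variable S : structure L M.
Variable lt : M -> M -> Prop.
Hypothesis O : omin_order S lt.
Implicit Types (A P Q : M -> Prop) (a b c u v x y z : M).

Let dlt : dfn2 S lt := oo_dfn O.

Definition right_germ a P := exists c, lt a c /\ forall x, lt a x -> lt x c -> P x.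

Definition is_inf A i :=
  (forall x, A x -> ~ lt x i) /\ forall j, lt i j -> exists x, A x /\ lt x j.

Definition is_min A i := A i /\ forall x, A x -> ~ lt x i.

Definition covered A := exists E : seq M, forall x, A x -> x \in E.

(** The boundary of [A] in the order topology. *)
Definition frontier A u := ~ exists l r, [/\ lt l u, lt u r &
  (forall v, lt l v -> lt v r -> A v) \/ (forall v, lt l v -> lt v r -> ~ A v)].

Lemma lt_meet a b c : lt a b -> lt a c -> exists e, [/\ lt a e, ~ lt b e & ~ lt c e].
Proof.
move=> ab ac; case: (oo_total O b c) => h; [exists b|exists b|exists c]; split=> //; ord.
Qed.

Lemma rg_and a P Q : right_germ a P -> right_germ a Q ->
  right_germ a (fun x => P x /\ Q x).
Proof.
move=> [c [ac hP]] [c' [ac' hQ]]; have [e [ae h1 h2]] := lt_meet ac ac'.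
by exists e; split=> // x ax xe; split; [apply: hP|apply: hQ] => //; ord.
Qed.

Lemma rg_mono a P Q : (forall x, P x -> Q x) -> right_germ a P -> right_germ a Q.
Proof. by move=> PQ [c [ac h]]; exists c; split=> // x ax xc; apply/PQ/h. Qed.

Lemma rg_lt a b : lt a b -> right_germ a (fun x => lt a x /\ lt x b).
Proof. by move=> ab; exists b. Qed.

Lemma rg_ex a P : right_germ a P -> exists x, lt a x /\ P x.
Proof. by move=> [c [ac h]]; have [z [az zc]] := oo_dense O ac; exists z; split=> //; apply: h. Qed.

Lemma rg_notin a (E : seq M) : right_germ a (fun x => x \notin E).
Proof.
elim: E => [|e E [c [ac IH]]].
  by have [c ac] := oo_hi O a; exists c.
have [ae|nae] := pselect (lt a e).
  have [b [ab h1 h2]] := lt_meet ac ae; exists b; split=> // x ax xb.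
  rewrite in_cons negb_or; apply/andP; split; last by apply: IH => //; ord.
  by apply/eqP => xe; ord.
exists c; split=> // x ax xc; rewrite in_cons negb_or IH // andbT.
by apply/eqP => xe; ord.
Qed.

(** Just to the right of [a] there is no point of the exceptional list, so membership in [A] is
    constant there. *)
Lemma rg_decide a A : dfn1 S A -> right_germ a A \/ right_germ a (fun x => ~ A x).
Proof.
move=> /(oo_tame O)[E hE].
have [c [ac h]] := rg_notin a E; have [z [az zc]] := oo_dense O ac.
have H x : lt a x -> lt x c -> (A x <-> A z).
  move=> ax xc; have hh y y' : lt a y -> lt y y' -> lt y' c -> A y <-> A y'.
    move=> ay yy y'c; apply: hE => // e eE.
    apply: contrapT => k; have : e \notin E by apply: h; ord.
    by rewrite eE.
  case: (oo_total O x z) => xz; [exact: hh|by rewrite xz|by symmetry; apply: hh].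
have [Az|nAz] := pselect (A z); [left|right]; exists c; split=> // x ax xc.
  exact/(H x).
by rewrite H.
Qed.

Lemma rg_freq a A : dfn1 S A ->
  (forall c, lt a c -> exists x, [/\ lt a x, lt x c & A x]) -> right_germ a A.
Proof.
move=> dA h; have [//|[c [ac hc]]] := rg_decide a dA.
by have [x [ax xc /(hc _ ax xc)]] := h _ ac.
Qed.

Lemma rg_not a P Q : right_germ a P -> right_germ a Q ->
  (forall x, lt a x -> P x -> Q x -> False) -> False.
Proof. by move=> hP hQ h; have [x [ax []]] := rg_ex (rg_and hP hQ); exact: h. Qed.

(** Dedekind completeness for definable initial segments. Induction on the exceptional list: a point
    [e] of it lies outside [[m, x0]], or is the cut itself, or lies outside a smaller interval of
    the same kind. *)
Lemma cut_exists A m x0 : dfn1 S A -> (forall x y, lt x y -> A y -> A x) ->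
  A m -> ~ A x0 -> exists i, (forall y, lt y i -> A y) /\ (forall y, lt i y -> ~ A y).
Proof.
move=> /(oo_tame O)[E hE] down Am nAx0.
have mx : lt m x0.
  by case: (oo_total O m x0) => // h; exfalso; [subst|have := down _ _ h Am].
(* Tameness is restricted to points between [m] and [x0], so that the interval can shrink in the
   induction. *)
have {hE} : forall x y, ~ lt x m -> ~ lt x0 y -> lt x y ->
    (forall e, e \in E -> lt e x \/ lt y e) -> (A x <-> A y) by move=> *; exact: hE.
elim: E m x0 Am nAx0 mx => [|e E IH] m x0 Am nAx0 mx hE.
  by exfalso; apply: nAx0; apply/(hE m) => //; ord.
have [em|nem] := pselect (lt e m \/ lt x0 e).
  apply: (IH m x0) => // x y h1 h2 xy h; apply: hE => // e'.
  by rewrite in_cons => /orP[/eqP->|/h //]; case: em => ?; [left|right]; ord.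
have [h1|h1] := pselect (forall y, lt y e -> A y); last first.
  have [y] : exists y, lt y e /\ ~ A y.
    by apply: contrapT => h2; apply: h1 => y ye; apply: contrapT => h3; apply: h2; exists y.
  move=> [ye nAy]; have my : lt m y.
    by case: (oo_total O m y) => // h; exfalso; [subst|have := down _ _ h Am].
  apply: (IH m y) => // x z xm yz xz h; apply: hE => //; first by ord.
  by move=> e'; rewrite in_cons => /orP[/eqP->|/h //]; right; ord.
have [h2|h2] := pselect (forall y, lt e y -> ~ A y); first by exists e.
have [y] : exists y, lt e y /\ A y.
  by apply: contrapT => h3; apply: h2 => y ye Ay; apply: h3; exists y.
move=> [ey Ay]; have yx : lt y x0.
  by case: (oo_total O y x0) => // h; exfalso; [subst|apply: nAx0; apply: down h Ay].
apply: (IH y x0) => // x z xm yz xz h; apply: hE => //; first by ord.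
by move=> e'; rewrite in_cons => /orP[/eqP->|/h //]; left; ord.
Qed.

Lemma inf_exists A x0 m : dfn1 S A -> A x0 -> (forall x, A x -> ~ lt x m) ->
  exists i, is_inf A i.
Proof.
move=> dA Ax0 hm.
have [z x0z] := oo_hi O x0.
have [] := @cut_exists (fun b => forall x, A x -> ~ lt x b) m z _ _ hm.
- by dfn_tac.
- by move=> x y xy h v /h; ord.
- by move=> /(_ _ Ax0).
move=> i [h1 h2]; exists i; split.
  move=> x Ax xi; have [y [xy yi]] := oo_dense O xi.
  exact: (h1 y yi x Ax).
move=> j ij; apply: contrapT => h; apply: (h2 j ij) => x Ax xj.
by apply: h; exists x.
Qed.

Lemma covered_sub A B : (forall x, A x -> B x) -> covered B -> covered A.
Proof. by move=> AB [E hE]; exists E => x /AB/hE. Qed.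

Lemma covered_min A x : covered A -> A x -> exists i, is_min A i.
Proof.
move=> [E]; elim: E A x => [A x /[apply]//|e E IH] A x hE Ax.
have [[y [Ay ye]]|h] := pselect (exists y, A y /\ y <> e); last first.
  have H y : A y -> y = e by move=> Ay; apply: contrapT => ?; apply: h; exists y.
  by exists x; split=> // y /H ->; rewrite (H x Ax); exact: oo_irr O _.
have [||i [[Ai ie] hi]] := IH (fun z => A z /\ z <> e) y; last 2 first.
- by [].
- have [[Ae ei]|h] := pselect (A e /\ lt e i).
    exists e; split=> // z Az ze; have zi : z <> e by ord.
    by apply: (hi z) => //; ord.
  exists i; split=> // z Az zi; have [ze|ze] := pselect (z = e).
    by subst; apply: h.
  exact: (hi z).
- by move=> z [/hE + /eqP/negPf ze]; rewrite in_cons ze.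
Qed.

(** A point of [A] off the exceptional list would have a right neighborhood inside [A]. *)
Lemma covered_no_germ A : dfn1 S A -> (forall a, ~ right_germ a A) -> covered A.
Proof.
move=> /(oo_tame O)[E hE] h; exists E => x Ax; apply: contrapT => /negP xE.
apply: (h x); have [c [xc hc]] := rg_notin x E.
exists c; split=> // y xy yc; apply/(hE x y) => // e eE.
case: (oo_total O e x) => ex; [by left|by rewrite -ex eE in xE|right].
case: (oo_total O y e) => // ye; last by have := hc e ex (oo_trans O ye yc); rewrite eE.
by have := hc _ xy yc; rewrite ye eE.
Qed.

(** Otherwise the infimum of the points outside [A] and not below [u1] is a frontier point of [A] in
    [[u1, u2]]. *)
Lemma connected A u1 u2 : dfn1 S A -> lt u1 u2 ->
  (forall v, ~ lt v u1 -> ~ lt u2 v -> ~ frontier A v) -> A u1 -> A u2.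
Proof.
move=> dA u12 hbd Au1; apply: contrapT => nAu2.
have [|||i [h1 h2]] := @inf_exists (fun v => ~ lt v u1 /\ ~ A v) u2 u1.
- by dfn_tac.
- by split=> //; ord.
- by move=> x [].
have iu1 : ~ lt i u1.
  by move=> /h2[x [[xu _]]]; exact: xu.
have iu2 : ~ lt u2 i by apply: h1; split=> //; ord.
have := hbd i iu1 iu2; apply=> -[l [r [li ir h]]].
have [x [[xu nAx] xr]] := h2 _ ir.
have xi := h1 x (conj xu nAx).
case: h => [h|h]; first by apply: nAx; apply: h => //; ord.
have u1i : lt u1 i.
  by case: (oo_total O u1 i) => // k; exfalso; apply: (h u1) => //; ord.
have [z [+ zi]] : exists z, (lt l z /\ lt u1 z) /\ lt z i.
  case: (oo_total O l u1) => k.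
  - by have [z [? ?]] := oo_dense O u1i; exists z; do !split=> //; ord.
  - by have [z [? ?]] := oo_dense O u1i; exists z; do !split=> //; ord.
  - by have [z [? ?]] := oo_dense O li; exists z; do !split=> //; ord.
move=> [lz uz]; apply: (h1 z) => //; split; first by ord.
by apply: h => //; ord.
Qed.

Lemma connected_iff A u1 u2 : dfn1 S A -> lt u1 u2 ->
  (forall v, ~ lt v u1 -> ~ lt u2 v -> ~ frontier A v) -> A u1 <-> A u2.
Proof.
move=> dA u12 h; split; first exact: connected.
move=> A2; apply: contrapT => n1.
suff : ~ A u2 by exact.
apply: (@connected (fun v => ~ A v) u1) => //; first exact: dfn_not.
move=> v v1 v2 nb; apply: (h v v1 v2) => -[l [r [lv vr k]]]; apply: nb.
by exists l, r; split=> //; case: k => k; [right => w lw wr; apply; exact: k|left].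
Qed.

(** Just to the right of any point [A] is constant, so there are no frontier points there. *)
Lemma frontier_covered A : dfn1 S A -> covered (frontier A).
Proof.
move=> dA; apply: covered_no_germ; first by rewrite /frontier; dfn_tac.
move=> a ha.
have [[c [ac hc]]|[c [ac hc]]] := rg_decide a dA;
  (have [x [[ax xc] bx]] : exists x, (lt a x /\ lt x c) /\ frontier A x by
    have [x [_]] := rg_ex (rg_and (rg_lt ac) ha); exists x);
  apply: bx; exists a, c; split=> //; [left|right]; exact: hc.
Qed.

End Germs.

(** * Continuity of definable functions *)

Section Continuity.
Variables (L : signature) (d : Order.disp_t) (M : orderType d).
Variable S : structure L M.
Implicit Types (lt : M -> M -> Prop) (f : M -> M).

(** Domain and range carry separate orders, so that each can be reversed independently. *)
Definition cont lt lt' f x := forall l h, lt' l (f x) -> lt' (f x) h ->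
  exists l0 r0, [/\ lt l0 x, lt x r0 &
    forall y, lt l0 y -> lt y r0 -> lt' l (f y) /\ lt' (f y) h].

Definition injective_on lt f a c := forall x y, lt a x -> lt x c ->
  lt a y -> lt y c -> f x = f y -> x = y.

Definition above lt lt' f x := right_germ lt x (fun y => lt' (f x) (f y)).

Definition flip lt := fun x y : M => lt y x.

Lemma inf_right_germ lt A i : omin_order S lt -> dfn1 S A -> is_inf lt A i ->
  ~ A i -> right_germ lt i A.
Proof.
move=> O dA [h1 h2] nAi; apply: (rg_freq O dA) => c ic.
have [x [Ax xc]] := h2 c ic; exists x; split=> //.
have := h1 x Ax; case: (oo_total O i x) => // ix; by subst.
Qed.

(** Suppose that just after [a] the function is nowhere locally constant and every value was taken
    earlier. The infimum of a fiber cannot exceed [a]: inside the fiber it would have an earlier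
    repetition, outside it the fiber would contain an interval. So the fiber accumulates at [a], and
    [f] is constant there by tameness. *)
Lemma const_or_injective lt f a : omin_order S lt -> dff S f ->
  exists c, lt a c /\ ((exists y, forall x, lt a x -> lt x c -> f x = y) \/
    injective_on lt f a c).
Proof.
move=> O df; have dlt := oo_dfn O.
pose lc x := exists l r, [/\ lt l x, lt x r &
  forall x', lt l x' -> lt x' r -> f x' = f x].
have dlc : dfn1 S lc by rewrite /lc; dfn_tac.
have [[c [ac hc]]|[c [ac hc]]] := rg_decide O a dlc.
  have bdv y v : lt a v -> lt v c -> ~ frontier lt (fun z => f z = y) v.
    move=> av vc; apply; have [l [r [lv vr h]]] := hc v av vc.
    exists l, r; split=> //; have [e|e] := pselect (f v = y); [left|right] => w lw wr;
    by rewrite h.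
  exists c; split=> //; left.
  have [x0 [ax0 x0c]] := oo_dense O ac; exists (f x0) => x ax xc.
  case: (oo_total O x0 x) => h; last 2 first.
  - by rewrite h.
  - symmetry; apply: (connected O (A := fun z => f z = f x) _ h) => //.
      by dfn_tac.
    by move=> v h1 h2; apply: bdv; ord.
  - apply: (connected O (A := fun z => f z = f x0) _ h) => //.
      by dfn_tac.
    by move=> v h1 h2; apply: bdv; ord.
(* [x] is the first point after [a] at which its value is taken. *)
pose Q x := forall x', lt a x' -> lt x' x -> f x' <> f x.
have dQ : dfn1 S Q by rewrite /Q; dfn_tac.
have [[c' [ac' hQ]]|nQ] := rg_decide O a dQ.
  exists c'; split=> //; right=> x y ax xc ay yc fxy.
  case: (oo_total O x y) => // h.
    by have := hQ y ay yc x ax h.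
  by have := hQ x ax xc y ay h; rewrite fxy.
have [c' [ac' hQ]] := rg_and O nQ (rg_lt ac).
have [x [ax xc]] := oo_dense O ac'.
have dfx : dfn1 S (fun z => f z = f x) by dfn_tac.
have [[e [ae he]]|[e [ae he]]] := rg_decide O a dfx.
  by exists e; split=> //; left; exists (f x).
pose X z := [/\ lt a z, lt z c' & f z = f x].
have dX : dfn1 S X by rewrite /X; dfn_tac.
have [|||i hi] := @inf_exists _ _ _ _ _ O X x a; [by []|by []|by move=> z [] *; ord|].
have [h1 h2] := hi.
have ai : lt a i.
  case: (oo_total O a i) => // h; exfalso.
    by subst; have [z [[az _ fz] ze]] := h2 _ ae; exact: (he z).
  by have [z [[az _ fz] ze]] := h2 _ h; ord.
have ix : ~ lt x i by apply: h1.
have [[_ _ Xi]|nXi] := pselect (X i).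
  have [nq _] := hQ i ai ltac:(ord); exfalso; apply: nq => x' ax' x'i fx'.
  by apply: (h1 x') => //; split=> //; [ord|rewrite fx'].
have [r [ir hr]] := inf_right_germ O dX hi nXi.
have [z [iz zr]] := oo_dense O ir; have [az zc fz] := hr z iz zr.
exfalso; have [_ [_ zc2]] := hQ z az zc; apply: (hc z az zc2).
by exists i, r; split=> // x' h3 h4; have [_ _ ->] := hr x' h3 h4.
Qed.

(** The value at [v] is left unconstrained; only a jump between the two sides is recorded. *)
Definition steps_up lt lt' f v := exists l r, [/\ lt l v, lt v r &
  forall y1 y2, lt l y1 -> lt y1 v -> lt v y2 -> lt y2 r -> lt' (f y1) (f y2)].

Lemma local_min_steps lt lt' f a c :
  omin_order S lt -> omin_order S lt' -> dff S f -> lt a c ->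
  injective_on lt f a c ->
  (forall x, lt a x -> lt x c -> above lt lt' f x /\ above (flip lt) lt' f x) ->
  right_germ lt a (steps_up lt lt' f).
Proof.
move=> O O' df ac finj hmin; have dlt := oo_dfn O; have dlt' := oo_dfn O'.
(* [x] has a smaller value than all earlier points. If this held near [a], then [f] would decrease
   there, against its growth to the right of each point. *)
pose B x := forall x', lt a x' -> lt x' x -> lt' (f x) (f x').
have dB : dfn1 S B by rewrite /B; dfn_tac.
have [hB|nB] := rg_decide O a dB.
  have [c' [ac' hc']] := rg_and O hB (rg_lt ac).
  have [x [ax xc']] := oo_dense O ac'.
  have [_ [_ xc]] := hc' x ax xc'.
  have [[r [xr hr]] _] := hmin x ax xc.
  have [e [xe h1 h2]] := lt_meet O xr xc'.
  have [y [xy ye]] := oo_dense O xe.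
  have h := hr y xy ltac:(ord).
  have [hy _] := hc' y ltac:(ord) ltac:(ord).
  by have h' := hy x ax xy; ord.
have {nB} [c' [ac' hc']] := rg_and O nB (rg_lt ac).
(* Otherwise take the infimum [i] of the earlier points with value below [f x]. If it is one of
   them, it satisfies [B]; if not, [f i] lies below nearby values that are below [f x], which makes
   it one of them after all. *)
have below x : lt a x -> lt x c' -> right_germ lt a (fun y => lt' (f y) (f x)).
  move=> ax xc'; have [nBx [_ xc]] := hc' x ax xc'.
  have dx : dfn1 S (fun y => lt' (f y) (f x)) by dfn_tac.
  have [//|[e [ae he]]] := rg_decide O a dx.
  exfalso.
  pose X y := [/\ lt a y, lt y x & lt' (f y) (f x)].
  have dX : dfn1 S X by rewrite /X; dfn_tac.
  have [y [ay yx fyx]] : exists y, X y.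
    apply: contrapT => nX; apply: nBx => y ay yx.
    case: (oo_total O' (f x) (f y)) => // h.
      have xy : x = y by apply: finj => //; ord.
      by exfalso; subst; ord.
    by exfalso; apply: nX; exists y.
  have [|||i hi] := @inf_exists _ _ _ _ _ O X y a; [by []|by []|by move=> z [] *; ord|].
  have [h1 h2] := hi.
  have ai : lt a i.
    case: (oo_total O a i) => // h; exfalso.
      by subst; have [z [[az _ fz] ze]] := h2 _ ae; exact: (he z).
    by have [z [[az _ fz] ze]] := h2 _ h; ord.
  have iy : ~ lt y i by apply: h1.
  have [Xi|nXi] := pselect (X i).
    case: Xi => _ ix fi; have [nBi _] := hc' i ai ltac:(ord).
    apply: nBi => z az zi.
    have nz : ~ lt' (f z) (f x) by move=> fz; apply: (h1 z) => //; split=> //; ord.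
    by ord.
  have ix : lt i x by ord.
  have [[r [ir hr]] _] := hmin i ai ltac:(ord).
  have [r' [ir' hr']] := inf_right_germ O dX hi nXi.
  have [e' [ie' k1 k2]] := lt_meet O ir ir'.
  have [z [iz ze']] := oo_dense O ie'.
  have [_ _ fz] := hr' z iz ltac:(ord).
  have fiz := hr z iz ltac:(ord).
  by apply: nXi; split=> //; ord.
have dS : dfn1 S (steps_up lt lt' f) by rewrite /steps_up; dfn_tac.
apply: (rg_freq O dS) => c0 ac0.
have [c1 [ac1 k1 k2]] := lt_meet O ac0 ac'.
have [x [ax xc1]] := oo_dense O ac1.
have [_ [_ xc]] := hc' x ax ltac:(ord).
have [e [ae he]] := below x ax ltac:(ord).
(* The infimum of this set is a step: values before it lie below [f x], values just after it do not.
   It lies left of [x], so the steps accumulate at [a]. *)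
pose X y := lt a y /\ ~ lt' (f y) (f x).
have dX : dfn1 S X by rewrite /X; dfn_tac.
have Xx : X x by split=> //; ord.
have [|i hi] := @inf_exists _ _ _ _ _ O X x a dX Xx; [by move=> z [] *; ord|].
have [h1 h2] := hi.
have ai : lt a i.
  case: (oo_total O a i) => // h; exfalso.
    by subst; have [z [[az fz] ze]] := h2 _ ae; apply: fz; exact: (he z).
  by have [z [[az fz] ze]] := h2 _ h; ord.
have ix : lt i x.
  have [_ [l [lx hl]]] := hmin x ax xc; rewrite /flip in lx hl.
  have [l' [xl' m1 m2]] := lt_meet (flip_order O) lx ax.
  have [z [xz zl']] := oo_dense (flip_order O) xl'.
  have k := hl z xz ltac:(ord).
  suff : ~ lt z i by ord.
  by apply: h1; split; ord.
have [[r [ir hr]] [l [li hl]]] := hmin i ai ltac:(ord); rewrite /flip in li hl.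
have below_i z : lt a z -> lt z i -> lt' (f z) (f x).
  by move=> az zi; apply: contrapT => nz; apply: (h1 z).
have [l' [il' m1 m2]] := lt_meet (flip_order O) li ai.
have nXi : ~ X i.
  move=> [_ nfi]; have [z [iz zl']] := oo_dense (flip_order O) il'.
  have k3 := hl z iz ltac:(ord); have k4 := below_i z ltac:(ord) iz; ord.
have [r' [ir' hr']] := inf_right_germ O dX hi nXi.
have [r0 [ir0 m3 m4]] := lt_meet O ir' ix.
exists i; split=> //; first by ord.
exists a, r0; split=> // y1 y2 ay1 y1i iy2 y2r0.
have k3 := below_i y1 ay1 y1i.
have [_ k4] := hr' y2 iy2 ltac:(ord).
by ord.
Qed.

(* Strict local minima everywhere make [f] step up, from left to right, at points
   accumulating at the left end [a]; by symmetry [f] steps down near the right end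
   of an interval on which it steps up everywhere. *)
Lemma local_min_absurd lt lt' f a c :
  omin_order S lt -> omin_order S lt' -> dff S f -> lt a c ->
  injective_on lt f a c ->
  (forall x, lt a x -> lt x c -> above lt lt' f x /\ above (flip lt) lt' f x) ->
  False.
Proof.
move=> O O' df ac finj hmin.
have [b [ab hb]] := rg_and O (local_min_steps O O' df ac finj hmin) (rg_lt ac).
have bc : ~ lt c b.
  move=> cb; have [x [cx xb]] := oo_dense O cb.
  by have [_ []] := hb x ltac:(ord) xb; ord.
have finj' : injective_on (flip lt) f b a.
  by move=> x y h1 h2 h3 h4; rewrite /flip in h1 h2 h3 h4; apply: finj => //; ord.
have [|e [be he]] := local_min_steps (flip_order O) O' df ab finj'.
  move=> x xb ax; have [|h1 h2] := hmin x ax; first by ord.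
  by split.
have [e' [be' k1 k2]] := lt_meet (flip_order O) be ab.
have [v [bv ve']] := oo_dense (flip_order O) be'.
have [l [r [vl rv h]]] := he v bv ltac:(ord).
have [[l' [r' [l'v vr' h']]] _] := hb v ltac:(ord) ltac:(ord).
have [p [lp m1 m2]] := lt_meet (flip_order O) rv l'v.
have [q [lq m3 m4]] := lt_meet O vl vr'.
have [y1 [vy1 py1]] := oo_dense (flip_order O) lp.
have [y2 [vy2 qy2]] := oo_dense O lq.
have g1 := h y2 y1 ltac:(ord) ltac:(ord) ltac:(ord) ltac:(ord).
have g2 := h' y1 y2 ltac:(ord) ltac:(ord) ltac:(ord) ltac:(ord).
ord.
Qed.

Definition increasing_on lt lt' f a c := forall x y, lt a x -> lt x y -> lt y c ->
  lt' (f x) (f y).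

(** Take the infimum [i] of the points after [x] whose values are not above [f x]. Growth just
    before [i] puts [f i] above [f x], and growth just after [i] keeps the values above it, so [i]
    is not that infimum. *)
Lemma local_increasing lt lt' f a c :
  omin_order S lt -> omin_order S lt' -> dff S f ->
  (forall x, lt a x -> lt x c ->
     above lt lt' f x /\ above (flip lt) (flip lt') f x) ->
  increasing_on lt lt' f a c.
Proof.
move=> O O' df h x y ax xy yc; have dlt := oo_dfn O; have dlt' := oo_dfn O'.
apply: contrapT => nfxy.
pose X z := lt x z /\ ~ lt' (f x) (f z).
have dX : dfn1 S X by rewrite /X; dfn_tac.
have [|||i hi] := @inf_exists _ _ _ _ _ O X y x; [by []|by []|by move=> z [] *; ord|].
have [h1 h2] := hi.
have [r [xr hr]] : above lt lt' f x by have [] := h x ax ltac:(ord).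
have xi : lt x i.
  case: (oo_total O x i) => // k; exfalso.
    by subst; have [z [[xz fz] zr]] := h2 _ xr; apply: fz; exact: hr.
  by have [z [[xz fz] zr]] := h2 _ k; ord.
have iy : ~ lt y i by apply: h1.
have [[r' [ir' hr']] [l [li hl]]] := h i ltac:(ord) ltac:(ord).
rewrite /flip in li hl.
have fxi : lt' (f x) (f i).
  have [l' [il' m1 m2]] := lt_meet (flip_order O) li xi.
  have [z [iz zl']] := oo_dense (flip_order O) il'.
  have k1 := hl z iz ltac:(ord).
  have k2 : lt' (f x) (f z).
    by apply: contrapT => k2; apply: (h1 z) => //; split=> //; ord.
  ord.
have nXi : ~ X i by move=> [].
have [r2 [ir2 hr2]] := inf_right_germ O dX hi nXi.
have [r3 [ir3 m1 m2]] := lt_meet O ir' ir2.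
have [z [iz zr3]] := oo_dense O ir3.
have k1 := hr' z iz ltac:(ord).
have [_ k2] := hr2 z iz ltac:(ord).
ord.
Qed.

(** The image is definable, so it contains an interval. Around a value in its interior there are
    attained values as close as desired, and monotonicity turns their preimages into a
    neighborhood. *)
Lemma increasing_cont lt lt' f a c :
  omin_order S lt -> omin_order S lt' -> dff S f -> lt a c ->
  increasing_on lt lt' f a c -> right_germ lt a (cont lt lt' f).
Proof.
move=> O O' df ac finc; have dlt := oo_dfn O; have dlt' := oo_dfn O'.
have dC : dfn1 S (cont lt lt' f) by rewrite /cont; dfn_tac.
have [//|[c1 [ac1 hc1]]] := rg_decide O a dC; exfalso.
have [b [ab k1 k2]] := lt_meet O ac ac1.
pose Y y := exists x, [/\ lt a x, lt x b & f x = y].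
have dY : dfn1 S Y by rewrite /Y; dfn_tac.
have [E hE] := oo_tame O' dY.
(* An increasing function takes each exceptional value at most once, so none is taken close to
   [a]. *)
have [b' [ab' hb']] : right_germ lt a (fun x => f x \notin E).
  elim: E {hE} => [|e E IH]; first by exists b.
  have de : dfn1 S (fun x => f x = e) by dfn_tac.
  have [[c' [ac' hc']]|h] := rg_decide O a de.
    exfalso; have [b1 [ab1 m1 m2]] := lt_meet O ac' ab.
    have [x1 [ax1 xb1]] := oo_dense O ab1.
    have [x2 [ax2 x21]] := oo_dense O ax1.
    have := finc x2 x1 ax2 x21 ltac:(ord).
    rewrite (hc' x1) ?(hc' x2) //; ord.
  apply: rg_mono (rg_and O IH h) => x [h1 h2].
  by rewrite in_cons negb_or h1 andbT; apply/eqP.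
have [b1 [ab1 m1 m2]] := lt_meet O ab ab'.
have [x0 [ax0 x0b1]] := oo_dense O ab1.
have fx0 := hb' x0 ax0 ltac:(ord).
have [r [fr hr]] := rg_notin O' (f x0) E.
have Yr y : lt' (f x0) y -> lt' y r -> Y y.
  move=> fy yr; apply/(hE (f x0) y) => //; last by exists x0; split=> //; ord.
  move=> e eE; case: (oo_total O' e (f x0)) => h; first by left.
    by rewrite -h eE in fx0.
  right; case: (oo_total O' y e) => // k.
    by subst; have := hr _ fy yr; rewrite eE.
  by have := hr _ h ltac:(ord); rewrite eE.
have [s [fs sr]] := oo_dense O' fr.
have [s' [fs' ss']] := oo_dense O' fs.
have [x1 [ax1 x1b fx1]] := Yr s' fs' ltac:(ord).
have [x2 [ax2 x2b fx2]] := Yr s fs ltac:(ord).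
have lift u v : lt a u -> lt u b -> lt a v -> lt v b -> lt' (f u) (f v) -> lt u v.
  move=> au ub av vb fuv; case: (oo_total O u v) => // k; exfalso.
    by subst; ord.
  by have k' := finc v u av k ltac:(ord); ord.
have x12 : lt x1 x2 by apply: lift => //; rewrite fx1 fx2.
have [x [x1x xx2]] := oo_dense O x12.
apply: (hc1 x); [by ord|by ord|] => l h lf fh.
have g1 := finc x1 x ax1 x1x ltac:(ord); have g2 := finc x x2 ltac:(ord) xx2 ltac:(ord).
rewrite fx1 in g1; rewrite fx2 in g2.
have [p [fp n1 n2]] := lt_meet (flip_order O') lf g1.
have [q [fq n3 n4]] := lt_meet O' fh g2.
have [p' [fp' pp']] := oo_dense (flip_order O') fp.
have [q' [fq' qq']] := oo_dense O' fq.
have [u [au ub fu]] := Yr p' ltac:(ord) ltac:(ord).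
have [v [av vb fv]] := Yr q' ltac:(ord) ltac:(ord).
exists u, v; split.
- by apply: lift; rewrite ?fu //; ord.
- by apply: lift; rewrite ?fv //; ord.
move=> y uy yv.
have := finc u y au uy ltac:(ord); have := finc y v ltac:(ord) yv ltac:(ord).
rewrite fu fv => e1 e2; split; ord.
Qed.

(** Unless [f] is constant near [a], tameness fixes on which side of [f x] the values just right and
    just left of [x] lie. Equal sides mean strict local minima or maxima, which is absurd; opposite
    sides give monotonicity, the decreasing case by reversing the order of the range. *)
Theorem rg_cont lt lt' f a :
  omin_order S lt -> omin_order S lt' -> dff S f ->
  right_germ lt a (cont lt lt' f).
Proof.
move=> O O' df; have dlt := oo_dfn O; have dlt' := oo_dfn O'.
have [c [ac [[y hy]|finj]]] := const_or_injective a O df.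
  exists c; split=> // x ax xc l h; rewrite hy // => ly yh.
  by exists a, c; split=> // z az zc; rewrite hy.
have dR : dfn1 S (above lt lt' f) by rewrite /above /right_germ; dfn_tac.
have dL : dfn1 S (above (flip lt) lt' f).
  by rewrite /above /flip /right_germ; dfn_tac.
have nR x : lt a x -> lt x c -> ~ above lt lt' f x -> above lt (flip lt') f x.
  move=> ax xc nx; have dx : dfn1 S (fun y => lt' (f x) (f y)) by dfn_tac.
  have [//|h] := rg_decide O x dx.
  have [e [xe he]] := rg_and O h (rg_lt xc).
  exists e; split=> // y xy ye; have [h1 [h2 h3]] := he y xy ye.
  rewrite /flip; case: (oo_total O' (f x) (f y)) => // k; exfalso.
  have k' : x = y by apply: finj => //; ord.
  ord.
have nL x : lt a x -> lt x c -> ~ above (flip lt) lt' f x ->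
    above (flip lt) (flip lt') f x.
  move=> ax xc nx; have dx : dfn1 S (fun y => lt' (f x) (f y)) by dfn_tac.
  have [//|h] := rg_decide (flip_order O) x dx.
  have [e [xe he]] := rg_and (flip_order O) h (rg_lt (lt:=flip lt) ax).
  exists e; split=> // y xy ye; have [h1 [h2 h3]] := he y xy ye.
  rewrite /flip in xy ye *; case: (oo_total O' (f x) (f y)) => // k; exfalso.
  have k' : x = y by apply: finj => //; ord.
  ord.
have sub c' : lt a c' -> ~ lt c c' -> injective_on lt f a c'.
  by move=> ac' cc' x z *; apply: finj => //; ord.
have shrink P Q : right_germ lt a P -> right_germ lt a Q -> exists c',
    [/\ lt a c', ~ lt c c' & forall x, lt a x -> lt x c' -> [/\ P x, Q x & lt x c]].
  move=> hP hQ.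
  have [c' [ac' hc']] := rg_and O (rg_and O hP hQ) (rg_lt ac).
  exists c'; split=> //; last by move=> x ax xc'; have [[? ?] [? ?]] := hc' x ax xc'.
  move=> cc'; have [x [h1 h2]] := oo_dense O cc'.
  have [_ [_ ?]] := hc' x ltac:(ord) h2; ord.
have [hR|hR] := rg_decide O a dR; have [hL|hL] := rg_decide O a dL;
  have [c' [ac' cc' hc']] := shrink _ _ hR hL.
- exfalso; apply: (local_min_absurd O O' df ac' (sub _ ac' cc')) => x ax xc'.
  by have [] := hc' x ax xc'.
- apply: (increasing_cont O O' df ac'); apply: local_increasing => // x ax xc'.
  by have [? ? ?] := hc' x ax xc'; split=> //; apply: nL.
- have : right_germ lt a (cont lt (flip lt') f).
    apply: (increasing_cont O (flip_order O') df ac').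
    apply: (local_increasing O (flip_order O') df) => x ax xc'.
    by have [? ? ?] := hc' x ax xc'; split=> //; apply: nR.
  apply: rg_mono => x hx l h lf fh; have [l0 [r0 [h1 h2 h3]]] := hx h l fh lf.
  by exists l0, r0; split=> // y k1 k2; have [] := h3 y k1 k2.
- exfalso; apply: (local_min_absurd O (flip_order O') df ac' (sub _ ac' cc')) => x ax xc'.
  by have [? ? ?] := hc' x ax xc'; split; [apply: nR|apply: nL].
Qed.

End Continuity.

(** * Planar sets with finite columns *)

Section Counting.
Variables (L : signature) (d : Order.disp_t) (M : orderType d).
Variable S : structure L M.
Variable lt : M -> M -> Prop.
Implicit Types (A B : M -> Prop) (k : nat).

Lemma atleast_sub k A B : (forall x, A x -> B x) ->
  atleast lt k A -> atleast lt k B.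
Proof.
elim: k A B => //= k IH A B AB [t [At h]]; exists t; split; first exact: AB.
by apply: IH h => x [/AB].
Qed.

Lemma atleast_ext k A B : (forall x, A x <-> B x) ->
  atleast lt k A <-> atleast lt k B.
Proof. by move=> AB; split; apply: atleast_sub => x /AB. Qed.

Lemma atleast_leq k k' A : (k <= k')%N -> atleast lt k' A -> atleast lt k A.
Proof.
elim: k k' A => [//|k IH] [//|k'] A /=; rewrite ltnS => kk' [t [At h]].
by exists t; split=> //; exact: IH h.
Qed.

Lemma atleast_size k A (E : seq M) : (forall x, x \in E \/ ~ A x) ->
  (forall x, ~ lt x x) -> atleast lt k A -> (k <= size E)%N.
Proof.
move=> + irr; elim: k A E => [//|k IH] A E hE /= [t [At h]].
have tE : t \in E by case: (hE t).
have : (0 < size E)%N by case: E tE {hE}.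
suff : (k <= size (rem t E))%N by rewrite size_rem //; case: (size E).
apply: IH h => x; have [xt|xt] := pselect (x = t).
  by right=> -[_]; rewrite xt; exact: irr.
have [xE|nAx] := hE x; last by right=> -[].
left; have := perm_to_rem tE => /perm_mem/(_ x).
by rewrite xE in_cons; move/eqP/negPf: xt => -> /=; move=> <-.
Qed.

Lemma covered_atleast A : (forall x, ~ lt x x) -> covered A ->
  exists k, ~ atleast lt k A.
Proof.
move=> irr [E hE]; exists (size E).+1 => h.
have hE' x : x \in E \/ ~ A x.
  by have [Ax|] := pselect (A x); [left; exact: hE|right].
by have := atleast_size hE' irr h; rewrite ltnn.
Qed.

Definition cut (v : M) A t := A t /\ lt t v.

Lemma atleast_cut1 A v w s j : omin_order S lt ->
  lt v s -> lt s w -> A s -> (forall t, ~ lt t v -> lt t w -> A t -> t = s) ->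
  atleast lt j.+1 (cut w A) <-> atleast lt j (cut v A).
Proof.
move=> O vs sw As us; split=> [[t [[At tw] h]]|h]; last first.
  exists s; split; first by split.
  by apply: atleast_sub h => x [Ax xv]; split=> //; [split=> //; ord|ord].
apply: atleast_sub h => x [[Ax xw] xt]; split=> //.
have xs : x <> s.
  move=> xs; have ts : t <> s by ord.
  by apply: ts; apply: us => //; ord.
by apply: contrapT => xv; apply: xs; exact: us.
Qed.

End Counting.

(** * Two-sided neighborhoods *)

Section Around.
Variables (L : signature) (d : Order.disp_t) (M : orderType d).
Variable S : structure L M.
Variable lt : M -> M -> Prop.
Hypothesis O : omin_order S lt.
Implicit Types (P Q : M -> Prop).

Definition around x P := exists l r, [/\ lt l x, lt x r &
  forall y, lt l y -> lt y r -> P y].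

Lemma around_and x P Q : around x P -> around x Q -> around x (fun y => P y /\ Q y).
Proof.
move=> [l [r [lx xr h]]] [l' [r' [lx' xr' h']]].
have [e [xe h1 h2]] := lt_meet O xr xr'.
have [e' [xe' h1' h2']] := lt_meet (flip_order O) lx lx'.
by exists e', e; split=> // y k1 k2; split; [apply: h|apply: h']; ord.
Qed.

Lemma around_mono x P Q : (forall y, P y -> Q y) -> around x P -> around x Q.
Proof. by move=> PQ [l [r [h1 h2 h]]]; exists l, r; split=> // y *; apply/PQ/h. Qed.

Lemma around_self x P : around x P -> P x.
Proof. by move=> [l [r [? ? h]]]; exact: h. Qed.

Lemma rg_around a P : right_germ lt a P -> right_germ lt a (fun x => around x P).
Proof. by move=> [c [ac h]]; exists c; split=> // x ax xc; exists a, c. Qed.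

End Around.

Section Planar.
Variables (L : signature) (d : Order.disp_t) (M : orderType d).
Variable S : structure L M.
Implicit Types (lt : M -> M -> Prop) (D : M -> M -> Prop).

(* The box [(s1, s2)] can be taken inside any given [(q1, q2)]: in the case of
   singleton columns this says that [D] is near [(u, t)] the graph of a function
   continuous at [u]. *)
Definition normal lt lt' D u t := forall q1 q2, lt' q1 t -> lt' t q2 ->
  exists s1 s2, [/\ lt' s1 t /\ ~ lt' s1 q1, lt' t s2 /\ ~ lt' q2 s2 &
    (D u t /\ around lt u (fun u' => exists t', (lt' s1 t' /\ lt' t' s2) /\
       (D u' t' /\ forall t'', lt' s1 t'' -> lt' t'' s2 -> D u' t'' -> t'' = t')))
    \/ around lt u (fun u' => forall t', lt' s1 t' -> lt' t' s2 -> ~ D u' t')].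

(** The behavior of [D] at infinity near [u]: bounded above or, with [lt'] reversed, bounded
    below. *)
Definition normal_end lt lt' D u :=
  exists t, around lt u (fun u' => forall t', lt' t t' -> ~ D u' t').

Definition good lt lt' D u :=
  [/\ normal_end lt lt' D u, normal_end lt (flip lt') D u &
      forall t, normal lt lt' D u t].

Lemma max_function D P lt : omin_order S lt -> dfn2 S D -> dfn2 S P ->
  (forall u, covered (D u)) ->
  exists f, dff S f /\ forall u t, D u t -> P u t ->
    [/\ D u (f u), P u (f u) & ~ lt (f u) t].
Proof.
move=> O dD dP hD; have dlt := oo_dfn O.
have [||f [df hf]] := @dff_sel _ _ _ S
  (fun u y => is_min (flip lt) (fun t => D u t /\ P u t) y).
- by rewrite /is_min /flip; dfn_tac.
- move=> x y y' [Dy hy] [Dy' hy']; rewrite /flip in hy hy'.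
  by have h1 := hy _ Dy'; have h2 := hy' _ Dy; ord.
exists f; split=> // u t Dt Pt.
have [|y /hf[[Df Pf] hm]] := covered_min (flip_order O)
  (A := fun t => D u t /\ P u t) (x := t) _ (conj Dt Pt).
  by apply: covered_sub (hD u) => x [].
by split=> //; apply: hm.
Qed.

Lemma rg_normal_end lt lt' D a : omin_order S lt -> omin_order S lt' ->
  dfn2 S D -> (forall u, covered (D u)) -> right_germ lt a (normal_end lt lt' D).
Proof.
move=> O O' dD hD.
have dT : dfn2 S (fun _ _ : M => True) by exact: dfn_cst.
have [f [df hf]] := max_function O' dD dT hD.
apply: rg_mono (rg_cont a O O' df) => u hu.
have [l lf] := oo_lo O' (f u); have [h fh] := oo_hi O' (f u).
exists h; apply: around_mono (hu l h lf fh) => u' [_ fu'] t' ht' Dt'.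
by have [_ _ k] := hf u' t' Dt' I; ord.
Qed.

(** The largest point of the column below [b u] varies continuously, so near [u] it stays under some
    [t] below [b u]. *)
Lemma rg_gap lt lt' D b a : omin_order S lt -> omin_order S lt' ->
  dfn2 S D -> (forall u, covered (D u)) -> dff S b ->
  right_germ lt a (fun u => exists t, lt' t (b u) /\
    around lt u (fun u' => forall t', D u' t' -> lt' t' (b u') -> lt' t' t)).
Proof.
move=> O O' dD hD db; have dlt' := oo_dfn O'.
have dE : dfn1 S (fun u => exists t, D u t /\ lt' t (b u)) by dfn_tac.
have [hE|hE] := rg_decide O a dE; last first.
  apply: rg_mono (rg_around hE) => u hu.
  have [t tb] := oo_lo O' (b u); exists t; split=> //.
  by apply: around_mono hu => u' hu' t' Dt' t'b; exfalso; apply: hu'; exists t'.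
have dP : dfn2 S (fun u t => lt' t (b u)) by dfn_tac.
have [f [df hf]] := max_function O' dD dP hD.
apply: rg_mono (rg_and O hE (rg_cont a O O' df)) => u [[t0 [Dt0 t0b]] hu].
have [_ fb _] := hf u t0 Dt0 t0b.
have [t [ft tb]] := oo_dense O' fb; have [l lf] := oo_lo O' (f u).
exists t; split=> //; apply: around_mono (hu l t lf ft) => u' [_ fu'] t' Dt' t'b.
by have [_ _ k] := hf u' t' Dt' t'b; ord.
Qed.

(** Let [b u] be the infimum of the heights at which normality fails. Gaps on both sides keep the
    other branches away, so in a strip around the height [b u] the set lies on the graph of the
    continuous function [b], and normality holds there after all. *)
Lemma rg_normal lt lt' D a : omin_order S lt -> omin_order S lt' ->
  dfn2 S D -> (forall u, covered (D u)) ->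
  right_germ lt a (fun u => forall t, normal lt lt' D u t).
Proof.
move=> O O' dD hD; have dlt := oo_dfn O; have dlt' := oo_dfn O'.
have dN : dfn2 S (normal lt lt' D) by rewrite /normal /around; dfn_tac.
have dA : dfn1 S (fun u => forall t, normal lt lt' D u t) by dfn_tac.
have [//|hN] := rg_decide O a dA; exfalso.
have [||b [db hb]] := @dff_sel _ _ _ S
  (fun u y => is_inf lt' (fun t => ~ normal lt lt' D u t) y).
- by rewrite /is_inf; dfn_tac.
- move=> x y y' [h1 h2] [h1' h2'].
  case: (oo_total O' y y') => // k; exfalso.
    by have [z [nz zy]] := h2 _ k; exact: h1' zy.
  by have [z [nz zy]] := h2' _ k; exact: h1 zy.
have hbinf u : normal_end lt (flip lt') D u -> ~ (forall t, normal lt lt' D u t) ->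
    is_inf lt' (fun t => ~ normal lt lt' D u t) (b u).
  move=> [m hm] /existsNP[t0 nt0].
  have dNu : dfn1 S (fun t => ~ normal lt lt' D u t) by dfn_tac.
  have [|y /hb //] := inf_exists (m := m) O' dNu nt0.
  move=> t nt tm; apply: nt => q1 q2 q1t tq2.
  have [s [ts h1 h2]] := lt_meet O' tq2 tm.
  exists q1, s; split; [by split=> //; ord|by []|right].
  by apply: around_mono hm => u' hu' t' _ t's; apply: hu'; rewrite /flip; ord.
have dP : dfn1 S (fun u => D u (b u)) by dfn_tac.
have hP : right_germ lt a (fun u => around lt u (fun u' => D u' (b u')) \/
    around lt u (fun u' => ~ D u' (b u'))).
  by have [h|h] := rg_decide O a dP; apply: rg_mono (rg_around h) => u; [left|right].
have [u [_ [[[[[nN nE] hg1] hg2] hc] {}hP]]] := rg_ex O (rg_and O (rg_and O (rg_and O (rg_and O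
  (rg_and O hN (rg_normal_end a O (flip_order O') dD hD))
  (rg_gap a O O' dD hD db)) (rg_gap a O (flip_order O') dD hD db))
  (rg_cont a O O' db)) hP).
have [inf1 inf2] := hbinf u nE nN.
have {hg1} [t1 [t1b g1]] := hg1; have {hg2} [t2 [bt2 g2]] := hg2.
have {inf2} [t [nt tt2]] := inf2 t2 bt2; have {inf1} bt := inf1 t nt.
have g u' : (forall t', D u' t' -> lt' t' (b u') -> lt' t' t1) ->
    (forall t', D u' t' -> flip lt' t' (b u') -> flip lt' t' t2) ->
    forall t', D u' t' -> lt' t1 t' -> lt' t' t2 -> t' = b u'.
  move=> k1 k2 t' Dt' h1 h2; have := k1 t' Dt'; have := k2 t' Dt'; rewrite /flip.
  by case: (oo_total O' t' (b u')) => // k m1 m2; exfalso;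
    [have := m2 k|have := m1 k]; ord.
(* If [t] is [b u], a box around it contains the graph of [b] or nothing of [D]; if [t] is higher,
   the box can be placed above the graph. *)
apply: nt => q1 q2 q1t tq2.
have [tb|tb] := pselect (t = b u).
  have [s1 [s1t h1 h2]] := lt_meet (flip_order O') q1t (eq_ind_r (lt' t1) t1b tb).
  have [s2 [ts2 h3 h4]] := lt_meet O' tq2 tt2.
  exists s1, s2; split=> //.
  have {}hc := hc s1 s2 ltac:(ord) ltac:(ord).
  case: hP => hP; [left; split|right].
  - by rewrite tb; exact: (around_self hP).
  - apply: around_mono (around_and O hP (around_and O hc (around_and O g1 g2))).
    move=> u' [Du' [[k1 k2] [k3 k4]]]; exists (b u'); split=> //; split=> // t'' h5 h6 Dt''.
    by apply: g => //; ord.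
  - apply: around_mono (around_and O hP (around_and O hc (around_and O g1 g2))).
    move=> u' [Du' [[k1 k2] [k3 k4]]] t'' h5 h6 Dt''.
    by apply: Du'; rewrite -(g u' k3 k4 t'') //; ord.
have {tb} bt' : lt' (b u) t by ord.
have [p [bp pt]] := oo_dense O' bt'.
have [s1 [s1t h1 h2]] := lt_meet (flip_order O') q1t pt.
have [s2 [ts2 h3 h4]] := lt_meet O' tq2 tt2.
exists s1, s2; split=> //; right.
have {}hc := hc t1 p t1b bp.
apply: around_mono (around_and O hc (around_and O g1 g2)).
move=> u' [[k1 k2] [k3 k4]] t'' h5 h6 Dt''.
by have := g u' k3 k4 t'' Dt'' ltac:(ord) ltac:(ord); ord.
Qed.

Theorem bad_covered lt lt' D : omin_order S lt -> omin_order S lt' ->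
  dfn2 S D -> (forall u, covered (D u)) -> covered (fun u => ~ good lt lt' D u).
Proof.
move=> O O' dD hD; have dlt := oo_dfn O; have dlt' := oo_dfn O'.
apply: (covered_no_germ O); first by rewrite /good /normal_end /flip /normal /around; dfn_tac.
move=> a ha; apply: (rg_not O ha
  (rg_and O (rg_and O (rg_normal_end a O O' dD hD)
    (rg_normal_end a O (flip_order O') dD hD)) (rg_normal a O O' dD hD))).
by move=> u au ngu [[h1 h2] h3]; apply: ngu.
Qed.

(** Count the points of the column below a height. At the infimum of the heights where this count is
    not locally constant, a normal box contains one branch or none, so passing through it changes
    the count by one or by zero. *)
Theorem good_locally_constant lt lt' D u : omin_order S lt -> omin_order S lt' ->
  dfn2 S D -> covered (D u) -> good lt lt' D u ->
  around lt u (fun u' => forall j, atleast lt' j (D u') <-> atleast lt' j (D u)).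
Proof.
move=> O O' dD hD [[p hp] [m hm] hN]; have dlt := oo_dfn O; have dlt' := oo_dfn O'.
have [K hK] := covered_atleast (oo_irr O') hD.
(* The column at [u] has fewer than [K] points; bounding [j] by [K] makes the condition
   first-order. *)
pose P v := around lt u (fun u' => forall j, (j <= K)%N ->
  (atleast lt' j (cut lt' v (D u')) <-> atleast lt' j (cut lt' v (D u)))).
(* Heights in [D u] are left out, because a branch through [(u, v)] may cross the height [v] near
   [u]. *)
pose X v := ~ D u v /\ ~ P v.
have dX : dfn1 S X by rewrite /X /P /around /cut; dfn_tac.
have [[w0 Xw0]|nX] := pselect (exists v, X v).
  exfalso; have [|i [inf1 inf2]] := inf_exists (m := m) O' dX Xw0.
    move=> v [_ nPv] vm; apply: nPv.
    apply: around_mono (around_and O hm hm) => u' [hu' _] j _.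
    apply: atleast_ext => x; split=> -[Dx xv]; exfalso.
      by apply: (hu' x) => //; rewrite /flip; ord.
    by apply: (around_self hm x) => //; rewrite /flip; ord.
  have [q1 q1i] := oo_lo O' i; have [q2 iq2] := oo_hi O' i.
  have [s1 [s2 [[s1i _] [is2 _]]]] := hN i q1 q2 q1i iq2.
  have [v [s1v vi]] := oo_dense O' s1i.
  have [w [[nDw nPw] ws2]] := inf2 s2 is2.
  have iw := inf1 w (conj nDw nPw).
  have hPv : ~ D u v -> P v.
    by move=> nDv; apply: contrapT => nPv; exact: (inf1 v (conj nDv nPv)).
  case=> [[Di hu]|hu].
    have {}hPv : P v.
      apply: hPv => Dv; have [t [_ [_ ut]]] := around_self hu.
      by have := ut v s1v ltac:(ord) Dv; have := ut i s1i is2 Di; ord.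
    have wi : w <> i by move=> wi; apply: nDw; rewrite wi.
    have iw' : lt' i w by ord.
    (* The first box makes the branch unique between [v] and [w]; a second box inside [(v, w)]
       ensures that the branch has a point there. *)
    have [s1' [s2' [[k1 k2] [k3 k4] []]]] := hN i v w vi iw'; last first.
      by move=> /around_self/(_ i k1 k3).
    move=> [_ hu'].
    have hcut : around lt u (fun u' => forall j,
        atleast lt' j.+1 (cut lt' w (D u')) <-> atleast lt' j (cut lt' v (D u'))).
      apply: around_mono (around_and O hu hu') => u' [[t [_ [_ ut]]] [s [[m1 m2] [Ds _]]]] j.
      apply: (atleast_cut1 (s := s) j O') => //; [ord|ord|] => x xv xw Dx.
      have -> : x = t by apply: ut => //; ord.
      by symmetry; apply: ut => //; ord.
    apply: nPw; apply: around_mono (around_and O hcut hPv) => u' [h1 h2] [//|j] jK.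
    by rewrite h1 (around_self hcut j) h2 // ltnW.
  have {}hPv : P v by apply: hPv; apply: (around_self hu) => //; ord.
  have hcut : around lt u (fun u' => forall x, cut lt' w (D u') x <-> cut lt' v (D u') x).
    apply: around_mono hu => u' hu' x; split=> -[Dx h]; split=> //; last by ord.
    by apply: contrapT => xv; apply: (hu' x) => //; ord.
  apply: nPw; apply: around_mono (around_and O hcut hPv) => u' [h1 h2] j jK.
  by rewrite (atleast_ext _ _ h1) (atleast_ext _ _ (around_self hcut)) h2.
have [v pv] := oo_hi O' p.
have nDv : ~ D u v by apply: (around_self hp).
have hPv : P v by apply: contrapT => nPv; apply: nX; exists v.
apply: around_mono (around_and O hp hPv) => u' [h1 h2].
have C u1 : (forall t', lt' p t' -> ~ D u1 t') -> forall x, cut lt' v (D u1) x <-> D u1 x.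
  move=> h x; split=> [[]//|Dx]; split=> //.
  by apply: contrapT => xv; apply: (h x) => //; ord.
have h3 j : (j <= K)%N -> (atleast lt' j (D u') <-> atleast lt' j (D u)).
  move=> jK; have := h2 j jK.
  by rewrite (atleast_ext _ _ (C _ h1)) (atleast_ext _ _ (C _ (around_self hp))).
move=> j; have [|Kj] := leqP j K; first exact: h3.
split=> h; exfalso; apply: hK; last exact: atleast_leq (ltnW Kj) h.
by apply/(h3 K) => //; exact: atleast_leq (ltnW Kj) h.
Qed.

End Planar.

(** * Uniform finiteness *)

Section Ultra.
Variable T : Type.
Implicit Types (F : set (set T)) (A B : set T).

Record ultra F : Prop := Ultra {
  ultraT : F setT;
  ultraI : forall A B, F A -> F B -> F (A `&` B);
  ultraS : forall A B, A `<=` B -> F A -> F B;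
  ultra0 : ~ F set0;
  ultraC : forall A, F A \/ F (~` A)
}.

Lemma ultra_exists I (D : set I) (B : I -> set T) : (exists i, D i) ->
  (forall i j, D i -> D j -> exists2 k, D k & B k `<=` B i `&` B j) ->
  (forall i, D i -> B i !=set0) ->
  exists F, ultra F /\ forall i, D i -> F (B i).
Proof.
move=> D0 DI B0; have FF := filter_from_filter D0 DI.
have [G [UG BG]] := ultraFilterLemma (filter_from_proper FF B0).
exists G; split; last by move=> i Di; apply: BG; exists i.
split.
- exact: filterT.
- by move=> A C; exact: filterI.
- by move=> A C; exact: filterS.
- exact: filter_not_empty.
- by move=> A; exact: in_ultra_setVsetC.
Qed.

Variable F : set (set T).
Hypothesis UF : ultra F.

Lemma ultra_ex A : F A -> exists x, A x.
Proof.
move=> FA; apply: contrapT => nA; apply: (ultra0 UF); apply: ultraS FA => //= x Ax.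
by apply: nA; exists x.
Qed.

Lemma ultra_incompat A B : F A -> F B -> (forall x, A x -> B x -> False) -> False.
Proof. by move=> FA FB h; have [x []] := ultra_ex (ultraI UF FA FB); exact: h. Qed.

Lemma ultra_not A : ~ F A -> F (fun x => ~ A x).
Proof. by case: (ultraC UF A). Qed.

Lemma ultra_or_seq (I : eqType) (s : seq I) (P : I -> set T) :
  F (fun x => exists2 i, i \in s & P i x) -> exists2 i, i \in s & F (P i).
Proof.
elim: s => [|i s IH] h; first by have [x []] := ultra_ex h.
have [Fi|nFi] := ultraC UF (P i); first by exists i => //; exact: mem_head.
have [|j js Fj] := IH; last by exists j => //; rewrite in_cons js orbT.
apply: ultraS (ultraI UF h nFi) => // x [[j]]; rewrite in_cons => /orP[/eqP->//|js] Pj _.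
by exists j.
Qed.

Lemma ultra_all_seq (I : eqType) (s : seq I) (P : I -> set T) :
  (forall i, i \in s -> F (P i)) -> F (fun x => forall i, i \in s -> P i x).
Proof.
elim: s => [|i s IH] h; first by apply: ultraS (ultraT UF).
have Fi := h i (mem_head _ _).
have Fs : F (fun x => forall i, i \in s -> P i x).
  by apply: IH => j js; apply: h; rewrite in_cons js orbT.
apply: ultraS (ultraI UF Fi Fs) => // x [Pi Ps] j; rewrite in_cons.
by case/orP=> [/eqP->//|]; exact: Ps.
Qed.

Lemma ultra_all_fin (I : finType) (P : I -> set T) :
  (forall i, F (P i)) -> F (fun x => forall i, P i x).
Proof.
move=> h; have := @ultra_all_seq _ (enum I) P (fun i _ => h i).
by apply: (ultraS UF) => x hx i; apply: hx; rewrite mem_enum.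
Qed.

End Ultra.

Lemma ultra_push T U (g : T -> U) F : ultra F -> ultra (fun B : set U => F (fun x => B (g x))).
Proof.
move=> UF; split.
- exact: ultraT UF.
- by move=> A B; exact: ultraI UF _ _.
- by move=> A B AB; apply: ultraS UF _ _ _ => x; exact: AB.
- exact: ultra0 UF.
- by move=> A; exact: ultraC UF (fun x => A (g x)).
Qed.

Lemma nat_step (P : nat -> Prop) K : P 0%N -> ~ P K ->
  exists2 j, (j < K)%N & P j /\ ~ P j.+1.
Proof.
elim: K => [//|K IH] P0 nPK.
have [PK|nP] := pselect (P K); first by exists K.
by have [//|j jK h] := IH P0; exists j => //; exact: leqW.
Qed.

(** * Changing, inserting and deleting a coordinate *)

Section Coordinates.
Variable M : Type.

Definition upd (V : eqType) (e : V -> M) i u : V -> M :=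
  fun v => if v == i then u else e v.

Definition insert n (i : 'I_n.+1) (s : 'I_n -> M) u : 'I_n.+1 -> M :=
  fun v => oapp s u (unlift i v).

Definition drop_at n (i : 'I_n.+1) (e : 'I_n.+1 -> M) : 'I_n -> M :=
  fun v => e (lift i v).

Lemma upd_upd (V : eqType) (e : V -> M) i u u' : upd (upd e i u) i u' = upd e i u'.
Proof. by apply: funext => v; rewrite /upd; case: eqP. Qed.

Lemma upd_at (V : eqType) (e : V -> M) i u : upd e i u i = u.
Proof. by rewrite /upd eqxx. Qed.

Lemma upd_id (V : eqType) (e : V -> M) i : upd e i (e i) = e.
Proof. by apply: funext => v; rewrite /upd; case: eqP => // ->. Qed.

Lemma insert_at n (i : 'I_n.+1) s u : insert i s u i = u.
Proof. by rewrite /insert unlift_none. Qed.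

Lemma drop_insert n (i : 'I_n.+1) s u : drop_at i (insert i s u) = s.
Proof. by apply: funext => v; rewrite /drop_at /insert liftK. Qed.

Lemma insert_drop n (i : 'I_n.+1) e u : insert i (drop_at i e) u = upd e i u.
Proof.
apply: funext => v; rewrite /insert /drop_at /upd.
by case: unliftP => [j ->|->]; [rewrite eq_sym (negbTE (neq_lift _ _))|rewrite eqxx].
Qed.

Lemma upd_insert n (i : 'I_n.+1) s u j v :
  upd (insert i s u) (lift i j) v = insert i (upd s j v) u.
Proof.
apply: funext => w; rewrite /insert /upd; case: unliftP => [k ->|->] /=.
  by rewrite (inj_eq lift_inj).
by rewrite (negbTE (neq_lift _ _)).
Qed.

Lemma drop_upd n (i : 'I_n.+1) e j v :
  drop_at i (upd e (lift i j) v) = upd (drop_at i e) j v.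
Proof. by apply: funext => w; rewrite /drop_at /upd (inj_eq lift_inj). Qed.

Lemma drop_upd_same n (i : 'I_n.+1) e v : drop_at i (upd e i v) = drop_at i e.
Proof.
by apply: funext => w; rewrite /drop_at /upd eq_sym (negbTE (neq_lift _ _)).
Qed.

End Coordinates.

(** * Generic ultrafilters and bounds on fibers *)

Section UniformFiniteness.
Variables (L : signature) (d : Order.disp_t) (M : orderType d).
Variable S : structure L M.
Variable lt : M -> M -> Prop.
Hypothesis O : omin_order S lt.

Let dlt : dfn2 S lt := oo_dfn O.

Lemma dfn_all_fin V (I : finType) (P : I -> (V -> M) -> Prop) :
  (forall i, dfn S (P i)) -> dfn S (fun e => forall i, P i e).
Proof.
move=> dP.
suff : dfn S (fun e => forall i, i \in enum I -> P i e).
  by apply: dfn_ext => e; split=> h i *; [apply: h; rewrite mem_enum|exact: h].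
elim: (enum I) => [|i s IH].
  by apply: dfn_ext (dfn_cst S V True) => e; split.
apply: dfn_ext (dfn_and (dP i) IH) => e; split=> [[h1 h2] j|h].
  by rewrite in_cons => /orP[/eqP->|/h2].
by split=> [|j js]; apply: h; rewrite in_cons ?eqxx ?js ?orbT.
Qed.

Lemma dfn_upd (V : eqType) (P : (V -> M) -> Prop) i :
  dfn S P -> dfnR S (fun e u => P (upd e i u)).
Proof.
move=> dP; apply: (dfn_subst (x := fun v (e : option V -> M) =>
  if v == i then e None else e (Some v)) dP) => v.
by case: eqP => _; exact: tm_var.
Qed.

Lemma dfn_insert n (P : ('I_n.+1 -> M) -> Prop) i :
  dfn S P -> dfnR S (fun s u => P (insert i s u)).
Proof.
move=> dP; apply: (dfn_subst (x := fun v (e : option 'I_n -> M) =>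
  if unlift i v is Some w then e (Some w) else e None) dP) => v.
by case: unlift => [w|]; exact: tm_var.
Qed.

Lemma dfn_at (V : eqType) (R : (V -> M) -> M -> Prop) i :
  dfnR S R -> dfn S (fun e => R e (e i)).
Proof. by move=> dR; apply: (dfn_fam dR) => [v|]; [exact: tm_var|exact: dft_var]. Qed.

Lemma dfn_drop n (R : ('I_n -> M) -> M -> Prop) (i : 'I_n.+1) :
  dfnR S R -> dfn S (fun e => R (drop_at i e) (e i)).
Proof.
move=> dR; apply: (dfn_fam dR (x := fun v (e : 'I_n.+1 -> M) => e (lift i v))) => [v|].
  exact: tm_var.
exact: dft_var.
Qed.

Lemma dfnR_frontier X (R : (X -> M) -> M -> Prop) : dfnR S R -> dfnR S (fun s => frontier lt (R s)).
Proof. by move=> dR; rewrite /frontier; dfn_tac. Qed.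

Lemma dfnR_around X (R : (X -> M) -> M -> Prop) :
  dfnR S R -> dfnR S (fun s u => around lt u (R s)).
Proof. by move=> dR; rewrite /around; dfn_tac. Qed.

Lemma dfn_fiber X (R : (X -> M) -> M -> Prop) e : dfnR S R -> dfn1 S (R e).
Proof.
move=> dR; apply: (dfn_fam dR (x := fun v _ => e v)) => [v|].
  exact: tm_cst.
exact: dft_var.
Qed.

Definition finite_along (V : eqType) i (A : (V -> M) -> Prop) : Prop :=
  forall e, covered (fun u => A (upd e i u)).

(* A tuple realizing [F] is independent with respect to algebraic closure. *)
Definition generic (V : eqType) (F : set (set (V -> M))) : Prop :=
  forall i A, dfn S A -> finite_along i A -> ~ F A.

(** The points of [A] where this fails lie on the frontier of the fiber along [i], so they form a
    set finite along [i]. *)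
Lemma generic_around (V : eqType) (F : set (set (V -> M))) i A :
  ultra F -> generic F -> dfn S A -> F A ->
  F (fun e => around lt (e i) (fun u => A (upd e i u))).
Proof.
move=> UF gF dA FA; have dR := dfn_upd i dA.
have dN : dfnR S (fun e u => around lt u (fun u' => A (upd e i u'))).
  exact: dfnR_around dR.
have [//|nF] := ultraC UF (fun e => around lt (e i) (fun u => A (upd e i u))); exfalso.
apply: (gF i (fun e => A e /\ ~ around lt (e i) (fun u => A (upd e i u)))).
- by apply: dfn_and => //; apply: dfn_not; exact: (dfn_at i dN).
- move=> e; have := frontier_covered O (dfn_fiber e dR).
  apply: covered_sub => u [Au nu] [l [r [lu ur [h|h]]]]; last exact: (h u).
  apply: nu; exists l, r; rewrite upd_at; split=> // y ly yr.
  by rewrite upd_upd; exact: h.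
- by apply: ultraS (ultraI UF FA nF).
Qed.

Definition uniformly_finite (X : Type) : Prop :=
  forall R : (X -> M) -> M -> Prop, dfnR S R -> (forall e, covered (R e)) ->
  exists k, forall e, ~ atleast lt k (R e).

(** Coordinate [0] is eliminated: on a member of [F] each fiber along it lies in one interval of
    [A], where local constancy gives constancy by connectedness. The conditions then depend on the
    other coordinates only. *)
Lemma locally_constant_bounded n (F : set (set ('I_n -> M)))
    (P : nat -> ('I_n -> M) -> Prop) A :
  (forall m, (m < n)%N -> uniformly_finite 'I_m) ->
  ultra F -> generic F -> (forall k, dfn S (P k)) -> (forall e, exists k, ~ P k e) ->
  dfn S A -> F A ->
  (forall i e, A e -> around lt (e i) (fun u => forall k, P k (upd e i u) <-> P k e)) ->
  exists k, F (fun e => ~ P k e).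
Proof.
elim: n F P A => [|n IH] F P A hU UF gF dP hP dA FA hA.
  have [e0 _] := ultra_ex UF (ultraT UF); have [k nP] := hP e0.
  exists k; apply: ultraS (ultraT UF) => // e _.
  by rewrite (_ : e = e0) //; apply: funext => -[].
pose A0 s u := A (insert ord0 s u).
have dA0 : dfnR S A0 by exact: dfn_insert.
pose R s := frontier lt (A0 s).
have dR : dfnR S R by exact: dfnR_frontier.
have [K hK] := hU n (ltnSn n) R dR (fun s => frontier_covered O (dfn_fiber s dA0)).
have FnR : F (fun e => ~ R (drop_at ord0 e) (e ord0)).
  apply: ultra_not => //; apply: (gF ord0); first exact: dfn_drop.
  move=> e; apply: covered_sub (frontier_covered O (dfn_fiber (drop_at ord0 e) dA0)) => u.
  by rewrite drop_upd_same upd_at.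
(* Fixing the number [j] of frontier points below [u] singles out one of boundedly many intervals of
   the fiber. *)
pose Q j s u := A0 s u /\ ~ R s u /\
  (atleast lt j (cut lt u (R s)) /\ ~ atleast lt j.+1 (cut lt u (R s))).
have dQ j : dfnR S (Q j).
  by move: R dR @Q {hK FnR} => R dR Q; rewrite /Q /cut; dfn_tac.
have [j _ FQ] : exists2 j, j \in iota 0 K & F (fun e => Q j (drop_at ord0 e) (e ord0)).
  apply: ultra_or_seq => //; apply: ultraS (ultraI UF FA FnR) => // e [Ae nRe].
  have [||j jK [h1 h2]] := @nat_step
    (fun j => atleast lt j (cut lt (e ord0) (R (drop_at ord0 e)))) K.
  - by [].
  - by move=> h; apply: (hK (drop_at ord0 e)); apply: atleast_sub h => x [].
  exists j; first by rewrite mem_iota.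
  by split=> //; rewrite /A0 insert_drop upd_id.
pose C e := Q j (drop_at ord0 e) (e ord0).
have dC : dfn S C by exact: dfn_drop.
have CE s u : C (insert ord0 s u) = Q j s u.
  by rewrite /C drop_insert insert_at.
have CA e : C e -> A e by rewrite /C => -[+ _]; rewrite /A0 insert_drop upd_id.
have convex s u1 u2 v : Q j s u1 -> Q j s u2 -> ~ lt v u1 -> ~ lt u2 v -> A0 s v.
  move=> Q1 Q2 h1 h2.
  have noR r : ~ lt r u1 -> ~ lt u2 r -> ~ R s r.
    move=> k1 k2 Rr.
    case: Q1 => _ [nR1 [q1 _]]; case: Q2 => _ [nR2 [_ q2]].
    have e1 : r <> u1 by move=> e1; apply: nR1; rewrite -e1.
    have e2 : r <> u2 by move=> e2; apply: nR2; rewrite -e2.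
    apply: q2; exists r; split; first by split=> //; ord.
    by apply: atleast_sub q1 => x [Rx xu]; split=> //; [split=> //; ord|ord].
  case: (oo_total O u1 v) => h; last 2 first.
  - by rewrite -h; case: Q1.
  - by have := h1 h.
  apply: (connected O (dfn_fiber s dA0) h); last by case: Q1.
  by move=> w k1 k2; apply: noR => //; ord.
have PC s u1 u2 k : Q j s u1 -> Q j s u2 ->
    (P k (insert ord0 s u1) <-> P k (insert ord0 s u2)).
  wlog h : u1 u2 / lt u1 u2.
    move=> H Q1 Q2; case: (oo_total O u1 u2) => h; [exact: H|by rewrite h|].
    by symmetry; exact: H.
  move=> Q1 Q2; have dPk := dfn_fiber s (dfn_insert ord0 (dP k)).
  apply: (connected_iff O dPk h) => v k1 k2.
  have Av := convex s u1 u2 v Q1 Q2 k1 k2; apply.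
  have := hA ord0 _ Av; rewrite insert_at => -[l [r [lv vr h']]].
  exists l, r; split=> //.
  have h'' w : lt l w -> lt w r -> P k (insert ord0 s w) <-> P k (insert ord0 s v).
    by move=> lw wr; rewrite -(h' w lw wr k) -insert_drop drop_insert.
  by have [pv|npv] := pselect (P k (insert ord0 s v)); [left|right] => w lw wr;
    rewrite h''.
(* By [PC] the choice of [u] is immaterial. *)
pose P' k s := exists u, Q j s u /\ P k (insert ord0 s u).
have dP' k : dfn S (P' k).
  apply: dfn_ex; apply: dfn_and; first exact: dQ.
  exact: dfn_insert.
have PP' k s u : Q j s u -> (P' k s <-> P k (insert ord0 s u)).
  move=> Qu; split=> [[u' [Qu' pu']]|pu]; last by exists u.
  by rewrite (PC s u u' k).
(* Genericity lets [C] persist under small changes of each other coordinate, so that [P'] inherits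
   local constancy from [P]. *)
pose A1 e := C e /\ forall i, around lt (e (lift ord0 i)) (fun v => C (upd e (lift ord0 i) v)).
have dA1 : dfn S A1.
  apply: dfn_and => //; apply: dfn_all_fin => i.
  apply: (dfn_at (lift ord0 i) (R := fun e u => around lt u (fun v => C (upd e (lift ord0 i) v)))).
  exact: dfnR_around (dfn_upd (lift ord0 i) dC).
have FA1 : F A1.
  by apply: ultraI => //; apply: ultra_all_fin => // i; exact: generic_around.
have [||||||||k Fk] := IH (fun B => F (fun e => B (drop_at ord0 e))) P'
  (fun s => exists u, A1 (insert ord0 s u)).
- by move=> m mn; apply: hU; exact: leqW.
- exact: ultra_push.
- move=> i B dB fB; apply: (gF (lift ord0 i)).
    apply: (dfn_subst (x := fun v (e : 'I_n.+1 -> M) => e (lift ord0 v)) dB) => v.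
    exact: tm_var.
  by move=> e; apply: covered_sub (fB (drop_at ord0 e)) => u; rewrite drop_upd.
- exact: dP'.
- move=> s; have [[u Qu]|nQ] := pselect (exists u, Q j s u).
    by have [k nk] := hP (insert ord0 s u); exists k; rewrite (PP' _ _ _ Qu).
  by exists 0%N => -[u [Qu _]]; apply: nQ; exists u.
- by apply: dfn_ex; exact: dfn_insert.
- by apply: ultraS FA1 => // e; exists (e ord0); rewrite insert_drop upd_id.
- move=> i s [u [Cu nu]]; have := nu i.
  have := hA (lift ord0 i) _ (CA _ Cu).
  have -> : insert ord0 s u (lift ord0 i) = s i.
    by rewrite -[RHS](congr1 (fun f => f i) (drop_insert ord0 s u)).
  move=> n1 n2; apply: around_mono (around_and O n1 n2) => v [h1 h2] k.
  move: h2 (h1 k); rewrite upd_insert CE => Qv hv.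
  by rewrite (PP' k _ _ Qv) hv (PP' k s u) // -CE.
exists k; apply: ultraS (ultraI UF FQ Fk) => // e [Qe nPe] Pe; apply: nPe.
by rewrite (PP' k _ _ Qe) insert_drop upd_id.
Qed.

Lemma covered_bigcup (P : M -> Prop) (Q : M -> M -> Prop) : covered P ->
  (forall u, P u -> covered (Q u)) -> covered (fun t => exists u, P u /\ Q u t).
Proof.
move=> [E hE] hQ.
have /choice[G hG] u : exists G : seq M, P u -> forall t, Q u t -> t \in G.
  by have [/hQ[G hG]|nP] := pselect (P u); [exists G|exists [::]].
exists (flatten [seq G u | u <- E]) => t [u [Pu Qut]].
by apply/flatten_mapP; exists u; [exact: hE|exact: hG Qut].
Qed.

Lemma uniformly_finite_ord n : uniformly_finite 'I_n.
Proof.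
elim/ltn_ind: n => n IH R dR cR; apply: contrapT => hR.
(* Without a uniform bound these sets are nonempty and decrease with [k], so some ultrafilter
   contains them all. *)
have [||| F [UF hF]] := @ultra_exists ('I_n -> M) nat setT (fun k e => atleast lt k (R e)).
- by exists 0%N.
- move=> i j _ _; exists (maxn i j) => // e h.
  by split; apply: atleast_leq h; rewrite ?leq_maxl ?leq_maxr.
- move=> k _; apply: contrapT => h; apply: hR; exists k => e he.
  by apply: h; exists e.
suff [k Fk] : exists k, F (fun e => ~ atleast lt k (R e)).
  by apply: (ultra_incompat UF (hF k I) Fk).
have [gF|ngF] := pselect (generic F).
  (* Generic case: [G i] fails only on a set finite along [i], so it holds on a member of [F]. *)
  pose G i e := good lt lt (fun u t => R (upd e i u) t) (e i).
  have dRi i e : dfn2 S (fun u t => R (upd e i u) t).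
    apply: (dfn_fam dR (x := fun v (f : bool -> M) => upd e i (f true) v)).
      by move=> v; rewrite /upd; case: eqP => _; [exact: tm_var|exact: tm_cst].
    exact: dft_var.
  have dG i : dfnR S (fun e u => good lt lt (fun u t => R (upd e i u) t) u).
    pose W e u t := R (upd e i u) t.
    have dA X (x : 'I_n -> (X -> M) -> M) (y z : (X -> M) -> M) :
        (forall v, tm S (x v)) -> tm S y -> tm S z ->
        dfn S (fun e => W (fun v => x v e) (y e) (z e)).
      move=> hx hy hz; apply: (dfn_fam dR (x := fun v e => if v == i then y e else x v e)).
        by move=> v; case: eqP.
      exact: dft_tm.
    change (dfn S (fun e : option 'I_n -> M => good lt lt (W (fun v => e (Some v))) (e None))).
    clearbody W.
    rewrite /good /normal_end /normal /flip /around.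
    repeat (cbv beta; first [apply: dA => [?||] | dfn_step]).
  apply: (@locally_constant_bounded n F (fun k e => atleast lt k (R e))
    (fun e => forall i, G i e)) => //.
  - by move=> k; exact: dfn_atleast.
  - by move=> e; exact: covered_atleast (oo_irr O) (cR e).
  - by apply: dfn_all_fin => i; exact: (dfn_at i (dG i)).
  - apply: ultra_all_fin => // i; apply: contrapT => /(ultra_not UF).
    apply: (gF i); first by apply: dfn_not; exact: (dfn_at i (dG i)).
    move=> e; have := bad_covered O O (dRi i e) (fun u => cR _).
    apply: covered_sub => u; rewrite /G upd_at.
    by rewrite (_ : (fun u' t => R (upd (upd e i u) i u') t) =
      (fun u' t => R (upd e i u') t)) //; apply: funext => u'; rewrite upd_upd.
  - move=> i e /(_ i) g; have := good_locally_constant O O (dRi i e) (cR _) g.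
    by rewrite upd_id.
move/existsNP: ngF => [i /existsNP[A /not_implyP[dA /not_implyP[fA /contrapT FA]]]].
case: n i IH R dR cR hR F UF hF A dA fA FA => [[]//|n] i IH R dR cR hR F UF hF A dA fA FA.
(* Remaining case: [A] is finite along [i], so the union of the columns over a fiber of [A] is
   finite. It depends on one coordinate less, and its bound applies to [R] on [A]. *)
pose W s t := exists u, A (insert i s u) /\ R (insert i s u) t.
have [|s|k hk] := IH n (ltnSn n) W.
- rewrite /W /dfnR; apply: dfn_ex; apply: dfn_and.
    apply: (dfn_fam (dfn_insert i dA)
      (x := fun v (f : option (option 'I_n) -> M) => f (Some (Some v)))).
      by move=> v; exact: tm_var.
    exact: dft_var.
  apply: (dfn_fam dR (x := fun v (f : option (option 'I_n) -> M) =>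
    if unlift i v is Some w then f (Some (Some w)) else f None)) => [v|].
    by case: unlift => [w|]; exact: tm_var.
  exact: dft_var.
- apply: covered_bigcup; last by move=> u _; exact: cR.
  have [z _] := ultra_ex UF (ultraT UF).
  apply: covered_sub (fA (insert i s (z i))) => u.
  by rewrite -insert_drop drop_insert.
exists k; apply: ultraS FA => // e Ae h; apply: (hk (drop_at i e)).
apply: atleast_sub h => t Rt; exists (e i).
by rewrite insert_drop upd_id.
Qed.

Lemma uniformly_finite_fin (X : finType) : uniformly_finite X.
Proof.
move=> R dR cR.
have [||k hk] := @uniformly_finite_ord #|X| (fun e => R (fun v => e (enum_rank v))).
- apply: (dfn_fam dR (x := fun v (f : option 'I_#|X| -> M) => f (Some (enum_rank v)))) => [v|].
    exact: tm_var.
  exact: dft_var.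
- by move=> e; exact: cR.
exists k => e; have := hk (fun j => e (enum_val j)).
rewrite (_ : (fun v => e (enum_val (enum_rank v))) = e) //.
by apply: funext => v; rewrite enum_rankK.
Qed.

End UniformFiniteness.

(** * Uniform bases of types *)

Section OMinimal.
Variables (L : signature) (d : Order.disp_t) (M : orderType d).
Variable S : structure L M.

Definition endpoints (I : interval M) : seq M :=
  let ends (b : itv_bound M) := if b is BSide _ a then [:: a] else [::] in
  let: Interval l r := I in ends l ++ ends r.

Lemma mem_itv_endpoints (I : interval M) (x y : M) : (x < y)%O ->
  (forall e, e \in endpoints I -> (e < x)%O \/ (y < e)%O) ->
  (x \in I) = (y \in I).
Proof.
case: I => l r xy h; rewrite !itv_boundlr; congr andb.
  case: l h => [b a|[]] //= h; have := h a; rewrite mem_head => /(_ isT).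
  by case: b {h} => -[ax|ya]; rewrite ?bnd_simp;
    [rewrite (ltW ax) (ltW (lt_trans ax xy))|rewrite !leNgt ya (lt_trans xy ya)|
     rewrite ax (lt_trans ax xy)|rewrite !ltNge (ltW ya) (ltW (lt_trans xy ya))].
case: r h => [b a|[]] //= h; have := h a; rewrite mem_cat mem_head orbT => /(_ isT).
by case: b {h} => -[ax|ya]; rewrite ?bnd_simp;
  [rewrite !ltNge (ltW ax) (ltW (lt_trans ax xy))|rewrite ya (lt_trans xy ya)|
   rewrite !leNgt ax (lt_trans ax xy)|rewrite (ltW ya) (ltW (lt_trans xy ya))].
Qed.

(** The endpoints of the finitely many intervals form the exceptional list. *)
Lemma o_minimal_order : o_minimal S -> omin_order S (fun x y : M => (x < y)%O).
Proof.
move=> [_ dense noends itvs]; split.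
- by move=> x; rewrite ltxx.
- by move=> x y z; exact: lt_trans.
- by move=> x y; case: (ltgtP x y) => h; [constructor 1|constructor 3|constructor 2].
- by move=> x y /dense[z /andP[? ?]]; exists z.
- by move=> x; have [b [c /andP[? _]]] := noends x; exists b.
- by move=> x; have [b [c /andP[_ ?]]] := noends x; exists c.
- by exists (Lt (Var true) (Var false)).
- move=> A dA.
  have [f hf] : dfn S (fun e : 'I_1 -> M => A (e ord0)).
    by apply: dfn_rel1 => //; exact: dft_var.
  have [s hs] := itvs f.
  exists (flatten [seq endpoints J | J <- s]) => x y xy h.
  have hx z : A z <-> exists2 J, J \in s & z \in J by rewrite -hs -hf.
  have E J : J \in s -> (x \in J) = (y \in J).
    by move=> Js; apply: mem_itv_endpoints => // e eJ; apply: h; apply/flatten_mapP; exists J.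
  by rewrite !hx; split=> -[J Js]; [rewrite E|rewrite -E] => //; exists J.
Qed.

End OMinimal.

(** * Directed families that decide given conditions *)

Section UniformSubtypes.
Variables (L : signature) (d : Order.disp_t) (M : orderType d).
Variable S : structure L M.
Variable lt : M -> M -> Prop.
Hypothesis O : omin_order S lt.

Let dlt : dfn2 S lt := oo_dfn O.

Definition dfnP (V W : Type) (P : (V -> M) -> (W -> M) -> Prop) : Prop :=
  dfn S (fun e : V + W -> M => P (fun v => e (inl v)) (fun w => e (inr w))).

Lemma dfnP_subst V W (P : (V -> M) -> (W -> M) -> Prop) U
    (x : V -> (U -> M) -> M) (y : W -> (U -> M) -> M) :
  dfnP P -> (forall v, tm S (x v)) -> (forall w, tm S (y w)) ->
  dfn S (fun e => P (fun v => x v e) (fun w => y w e)).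
Proof.
move=> dP hx hy.
by apply: (dfn_subst (x := fun v e => match v with inl v => x v e | inr w => y w e end) dP);
  case.
Qed.

(** The semantic form of a formula whose instances in the type are directed. Parameters are indexed
    by any finite type, so that sums and products of index types can be used as they are. *)
Definition uniform_base n (F : set (set ('I_n -> M))) (Z : finType)
    (Psi : ('I_n -> M) -> (Z -> M) -> Prop) : Prop :=
  [/\ dfnP Psi, exists c, F (fun a => Psi a c) &
    forall c c', F (fun a => Psi a c) -> F (fun a => Psi a c') ->
      exists c'', F (fun a => Psi a c'') /\
        forall a, Psi a c'' -> Psi a c /\ Psi a c'].

Definition decides n (F : set (set ('I_n -> M))) (Z : finType)
    (Psi : ('I_n -> M) -> (Z -> M) -> Prop) (A : ('I_n -> M) -> Prop) : Prop :=
  exists c, F (fun a => Psi a c) /\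
    ((forall a, Psi a c -> A a) \/ (forall a, Psi a c -> ~ A a)).

Lemma uniform_base_fin n F (Z : finType) Psi (I : finType) (c : I -> Z -> M) :
  @uniform_base n F Z Psi -> (forall i, F (fun a => Psi a (c i))) ->
  exists c', F (fun a => Psi a c') /\ forall i a, Psi a c' -> Psi a (c i).
Proof.
move=> [_ ne dir] hc.
suff [c' [Fc' h]] : exists c', F (fun a => Psi a c') /\
    forall i, i \in enum I -> forall a, Psi a c' -> Psi a (c i).
  by exists c'; split=> // i a; apply: h; rewrite mem_enum.
elim: (enum I) => [|i s [c' [Fc' IH]]]; first by have [c' Fc'] := ne; exists c'.
have [c'' [Fc'' h]] := dir _ _ Fc' (hc i).
exists c''; split=> // j; rewrite in_cons => /orP[/eqP-> a /h[]//|js a /h[+ _]].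
exact: IH.
Qed.

Definition ccut (v : M) (A : M -> Prop) t := A t /\ ~ lt v t.

(* The point or interval of which [t] is a member in the partition of the line
   by the finite set [A] is coded by the numbers [i], [i'] of points of [A]
   below [t], respectively not above [t]. *)
Definition cell (i i' : nat) A t :=
  (atleast lt i (cut lt t A) /\ ~ atleast lt i.+1 (cut lt t A)) /\
  (atleast lt i' (ccut t A) /\ ~ atleast lt i'.+1 (ccut t A)).

Lemma cell_exists K A t : ~ atleast lt K A ->
  exists2 q, q \in [seq (i, i') | i <- iota 0 K, i' <- iota 0 K] & cell q.1 q.2 A t.
Proof.
move=> hK.
have [||i iK h] := @nat_step (fun i => atleast lt i (cut lt t A)) K; first by [].
  by move=> h; apply: hK; apply: atleast_sub h => x [].
have [||i' iK' h'] := @nat_step (fun i => atleast lt i (ccut t A)) K; first by [].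
  by move=> h'; apply: hK; apply: atleast_sub h' => x [].
exists (i, i') => //; apply/allpairsP; exists (i, i').
by rewrite !mem_iota.
Qed.

(** A frontier point in [[t1, t2)] would raise the strict count between [t1] and [t2], and [t2] as a
    frontier point would raise the non-strict one. *)
Lemma cell_const A i i' t1 t2 : dfn1 S A ->
  cell i i' (frontier lt A) t1 -> cell i i' (frontier lt A) t2 -> A t1 <-> A t2.
Proof.
move=> dA; wlog t12 : t1 t2 / lt t1 t2.
  move=> H h1 h2; case: (oo_total O t1 t2) => h; [exact: H|by rewrite h|].
  by symmetry; exact: H.
move=> [[l1 _] [r1 _]] [[_ l2] [_ r2]].
apply: (connected_iff O dA t12) => v v1 v2 bv.
case: (oo_total O v t2) => v2'; last by [].
  apply: l2; exists v; split=> //.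
  by apply: atleast_sub l1 => x [bx xt]; split=> //; [split=> //; ord|ord].
apply: r2; exists v; split=> //.
by apply: atleast_sub r1 => x [bx xt]; split=> //; [split=> //; ord|ord].
Qed.

Lemma atleast_cut_up k A t t' : lt t t' ->
  atleast lt k (cut lt t A) -> atleast lt k (cut lt t' A).
Proof. by move=> tt'; apply: atleast_sub => x [Ax xt]; split=> //; ord. Qed.

Lemma atleast_ccut_up k A t t' : lt t t' ->
  atleast lt k (ccut t A) -> atleast lt k (ccut t' A).
Proof. by move=> tt'; apply: atleast_sub => x [Ax xt]; split=> //; ord. Qed.

(* Sets upward closed in the last variable are linearly ordered by inclusion in
   each fiber, so that finitely many of them reduce to a single one as soon as
   [Psi'] decides the inclusions. *)
Lemma extend_base n (F : set (set ('I_n.+1 -> M))) (W G Z' : finType)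
    (H : G -> ('I_n -> M) -> M -> (W -> M) -> Prop)
    (Psi' : ('I_n -> M) -> (Z' -> M) -> Prop) :
  ultra F ->
  (forall g, dfnP (fun e b => H g (drop_at ord0 e) (e ord0) b)) ->
  (forall g s b t t', lt t t' -> H g s t b -> H g s t' b) ->
  let F' := fun B : set ('I_n -> M) => F (fun e => B (drop_at ord0 e)) in
  uniform_base F' Psi' ->
  (forall g b b', decides F' Psi' (fun s => forall t, H g s t b -> H g s t b')) ->
  exists (Z : finType) (Psi : ('I_n.+1 -> M) -> (Z -> M) -> Prop),
    uniform_base F Psi /\
    forall b c', F' (fun s => Psi' s c') -> exists c, F (fun e => Psi e c) /\
      forall e, Psi e c -> Psi' (drop_at ord0 e) c' /\
        forall g, (F (fun e => H g (drop_at ord0 e) (e ord0) b) ->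
                   H g (drop_at ord0 e) (e ord0) b) /\
                  (~ F (fun e => H g (drop_at ord0 e) (e ord0) b) ->
                   ~ H g (drop_at ord0 e) (e ord0) b).
Proof.
move=> UF dH up F' bPsi' dec.
pose HH g b (e : 'I_n.+1 -> M) := H g (drop_at ord0 e) (e ord0) b.
(* [Psi] joins to [Psi'] one instance of each [H g] in [F] and the negation of one outside [F]. The
   guards [gp] and [gm] drop the conjuncts for which no such parameter exists. *)
pose gp g := exists b, F (HH g b).
pose gm g := exists b, ~ F (HH g b).
pose Z : finType := (Z' + (G * W + G * W))%type.
pose Psi e (z : Z -> M) := Psi' (drop_at ord0 e) (fun w => z (inl w)) /\
  ((forall g, gp g -> HH g (fun w => z (inr (inl (g, w)))) e) /\
   (forall g, gm g -> ~ HH g (fun w => z (inr (inr (g, w)))) e)).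
pose mk (c : Z' -> M) (u v : G -> W -> M) : Z -> M := fun z =>
  match z with
  | inl w => c w | inr (inl (g, w)) => u g w | inr (inr (g, w)) => v g w
  end.
have Fmk c u v : F' (fun s => Psi' s c) -> (forall g, gp g -> F (HH g (u g))) ->
    (forall g, gm g -> ~ F (HH g (v g))) -> F (fun e => Psi e (mk c u v)).
  move=> Fc Fu Fv; apply: (ultraI UF) => //; apply: (ultraI UF).
    apply: (ultra_all_fin UF) => g; have [h|h] := pselect (gp g).
      by apply: ultraS (Fu g h) => // e.
    by apply: ultraS (ultraT UF).
  apply: (ultra_all_fin UF) => g; have [h|h] := pselect (gm g).
    by apply: ultraS (ultra_not UF (Fv g h)) => // e.
  by apply: ultraS (ultraT UF).
have Fun z : F (fun e => Psi e z) -> [/\ F' (fun s => Psi' s (fun w => z (inl w))),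
    forall g, gp g -> F (HH g (fun w => z (inr (inl (g, w))))) &
    forall g, gm g -> ~ F (HH g (fun w => z (inr (inr (g, w)))))].
  move=> Fz; split.
  - by apply: (ultraS UF _ Fz) => e [].
  - by move=> g hg; apply: ultraS Fz => // e [_ [h _]]; exact: h.
  - by move=> g hg h; apply: (ultra_incompat UF Fz h) => e [_ [_ k]]; exact: k.
have /choice[u0 hu0] g : exists b, gp g -> F (HH g b).
  have [[b hb]|h] := pselect (gp g); first by exists b.
  by have [e _] := ultra_ex UF (ultraT UF); exists (fun=> e ord0).
have /choice[v0 hv0] g : exists b, gm g -> ~ F (HH g b).
  have [[b hb]|h] := pselect (gm g); first by exists b.
  by have [e _] := ultra_ex UF (ultraT UF); exists (fun=> e ord0).
(* If [Psi'] refutes one inclusion in every fiber, upward closure gives the opposite inclusion. *)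
have cmp g b b' : exists c, F' (fun s => Psi' s c) /\
    ((forall s, Psi' s c -> forall t, H g s t b -> H g s t b') \/
     (forall s, Psi' s c -> forall t, H g s t b' -> H g s t b)).
  have [c [Fc [h|h]]] := dec g b b'; exists c; split=> //; [by left|right].
  move=> s /h/existsNP[t /not_implyP[Ht nHt]] t' Ht'.
  case: (oo_total O t t') => tt'.
  - exact: up tt' Ht.
  - by subst.
  - by have := up _ _ _ _ _ tt' Ht'.
exists Z, Psi; split; last first.
  move=> b c' Fc'.
  (* For each [g], [b] goes to the side that [F] confirms, and the other side takes a default
     parameter. *)
  pose u g := if pselect (F (HH g b)) is left _ then b else u0 g.
  pose v g := if pselect (F (HH g b)) is left _ then v0 g else b.
  exists (mk c' u v); split.
    apply: Fmk => // g hg; rewrite ?/u ?/v; case: pselect => // h; [exact: hu0|exact: hv0].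
  move=> e [Pc [Pu Pv]]; split=> // g; split=> h.
    have := Pu g (ex_intro _ b h); rewrite /HH /= /u; case: pselect => // h'.
  have := Pv g (ex_intro _ b h); rewrite /HH /= /v; case: pselect => // h'.
split.
- apply: dfn_and.
    apply: (dfnP_subst (x := fun v (e : 'I_n.+1 + Z -> M) => e (inl (lift ord0 v)))
      (y := fun w (e : 'I_n.+1 + Z -> M) => e (inr (inl w))) (let: And3 h _ _ := bPsi' in h)) => v;
      exact: tm_var.
  apply: dfn_and; apply: dfn_all_fin => g; apply: dfn_imp; try exact: dfn_cst.
    apply: (dfnP_subst (x := fun v (e : 'I_n.+1 + Z -> M) => e (inl v))
      (y := fun w (e : 'I_n.+1 + Z -> M) => e (inr (inr (inl (g, w))))) (dH g)) => v;
      exact: tm_var.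
  apply: dfn_not.
  apply: (dfnP_subst (x := fun v (e : 'I_n.+1 + Z -> M) => e (inl v))
    (y := fun w (e : 'I_n.+1 + Z -> M) => e (inr (inr (inr (g, w))))) (dH g)) => v;
    exact: tm_var.
- have [_ [c0 Fc0] _] := bPsi'.
  by exists (mk c0 u0 v0); exact: Fmk.
- move=> z z' /Fun[Fz Fu Fv] /Fun[Fz' Fu' Fv'].
  (* Positive conjuncts: keep the smaller of the two sets. The second component is the instance of
     [Psi'] that certifies the comparison. *)
  have /choice[w1 hw1] g : exists w : (W -> M) * (Z' -> M),
      [/\ gp g -> F (HH g w.1), F' (fun s => Psi' s w.2) &
        forall s t, Psi' s w.2 -> H g s t w.1 ->
          H g s t (fun w => z (inr (inl (g, w)))) /\ H g s t (fun w => z' (inr (inl (g, w))))].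
    have [c [Fc [h|h]]] := cmp g (fun w => z (inr (inl (g, w)))) (fun w => z' (inr (inl (g, w)))).
      by exists (fun w => z (inr (inl (g, w))), c); split=> //= [|s t Pc Ht];
        [exact: Fu|split=> //; exact: h].
    by exists (fun w => z' (inr (inl (g, w))), c); split=> //= [|s t Pc Ht];
      [exact: Fu'|split=> //; exact: h].
  (* Negative conjuncts: keep the larger set, whose complement is the smaller. *)
  have /choice[w2 hw2] g : exists w : (W -> M) * (Z' -> M),
      [/\ gm g -> ~ F (HH g w.1), F' (fun s => Psi' s w.2) &
        forall s t, Psi' s w.2 -> ~ H g s t w.1 ->
          ~ H g s t (fun w => z (inr (inr (g, w)))) /\ ~ H g s t (fun w => z' (inr (inr (g, w))))].
    have [c [Fc [h|h]]] := cmp g (fun w => z (inr (inr (g, w)))) (fun w => z' (inr (inr (g, w)))).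
      by exists (fun w => z' (inr (inr (g, w))), c); split=> //= [|s t Pc Ht];
        [exact: Fv'|split=> // k; apply: Ht; exact: h].
    by exists (fun w => z (inr (inr (g, w))), c); split=> //= [|s t Pc Ht];
      [exact: Fv|split=> // k; apply: Ht; exact: h].
  have [|c [Fc hc]] := @uniform_base_fin n F' Z' Psi' (G + G + bool)%type (fun i => match i with
    | inl (inl g) => (w1 g).2 | inl (inr g) => (w2 g).2
    | inr true => fun w => z (inl w) | inr false => fun w => z' (inl w) end) bPsi'.
    by case=> [[g|g]|[]] //; [have [] := hw1 g|have [] := hw2 g].
  exists (mk c (fun g => (w1 g).1) (fun g => (w2 g).1)); split.
    by apply: Fmk => // g; [have [] := hw1 g|have [] := hw2 g].
  move=> e [Pc [Pu Pv]]; have hc' i := hc i _ Pc.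
  split; (split; [|split=> g hg]).
  + exact: (hc' (inr true)).
  + have [_ _ k] := hw1 g; exact: (k _ _ (hc' (inl (inl g))) (Pu g hg)).1.
  + have [_ _ k] := hw2 g; exact: (k _ _ (hc' (inl (inr g))) (Pv g hg)).1.
  + exact: (hc' (inr false)).
  + have [_ _ k] := hw1 g; exact: (k _ _ (hc' (inl (inl g))) (Pu g hg)).2.
  + have [_ _ k] := hw2 g; exact: (k _ _ (hc' (inl (inr g))) (Pv g hg)).2.
Qed.

Theorem deciding_base n (F : set (set ('I_n -> M))) (W J : finType)
    (Phi : J -> ('I_n -> M) -> (W -> M) -> Prop) :
  ultra F -> (forall j, dfnP (Phi j)) ->
  exists (Z : finType) (Psi : ('I_n -> M) -> (Z -> M) -> Prop),
    uniform_base F Psi /\ forall j b, decides F Psi (fun a => Phi j a b).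
Proof.
elim: n F W J Phi => [|n IH] F W J Phi UF dPhi.
  (* There is only one tuple of length zero, so the trivial condition decides everything. *)
  exists void, (fun _ _ => True); split.
    split; first exact: dfn_cst.
      by exists (fun v : void => match v with end); exact: ultraT UF.
    by move=> c c' _ _; exists c; split; first exact: ultraT UF.
  move=> j b; exists (fun v : void => match v with end).
  split; first exact: ultraT UF.
  have [e0 _] := ultra_ex UF (ultraT UF).
  have E e : e = e0 by apply: funext => -[].
  by have [h|h] := pselect (Phi j e0 b); [left|right] => e _; rewrite (E e).
pose A j (sb : 'I_n + W -> M) t :=
  Phi j (insert ord0 (fun i => sb (inl i)) t) (fun w => sb (inr w)).
have dA j : dfnR S (A j).
  apply: (dfnP_subst (x := fun v (e : option ('I_n + W) -> M) =>
    if unlift ord0 v is Some w then e (Some (inl w)) else e None)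
    (y := fun w (e : option ('I_n + W) -> M) => e (Some (inr w))) (dPhi j)) => v.
    by case: unlift => [w|]; exact: tm_var.
  exact: tm_var.
pose R j (s : 'I_n -> M) (b : W -> M) :=
  frontier lt (A j (fun v => match v with inl i => s i | inr w => b w end)).
have dR j : dfnR S (fun sb : 'I_n + W -> M => frontier lt (A j sb)) by exact: dfnR_frontier.
have /choice[Kj hKj] j : exists k, forall s b, ~ atleast lt k (R j s b).
  have [k hk] := uniformly_finite_fin O (dR j) (fun sb => frontier_covered O (dfn_fiber sb (dA j))).
  by exists k => s b; exact: hk.
pose K := \max_j Kj j.
have hK j s b : ~ atleast lt K (R j s b).
  by move=> h; apply: (hKj j s b); apply: atleast_leq h; exact: leq_bigmax.
(* Counts up to [K] included are indexed, since a cell with code [i < K] excludes [i.+1] points. *)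
pose G : finType := (J * 'I_K.+1 * bool)%type.
pose H (g : G) s t b := let: (j, i, strict) := g in
  if strict then atleast lt i (cut lt t (R j s b)) else atleast lt i (ccut t (R j s b)).
have dH g X (x : 'I_n -> (X -> M) -> M) (y : (X -> M) -> M) (z : W -> (X -> M) -> M) :
    (forall v, tm S (x v)) -> tm S y -> (forall w, tm S (z w)) ->
    dfn S (fun e => H g (fun v => x v e) (y e) (fun w => z w e)).
  move=> hx hy hz; case: g => [[j i] strict].
  have dR' : dfnR S (fun e : X -> M => R j (fun v => x v e) (fun w => z w e)).
    rewrite /R; move: (dR j); set B := (fun sb => frontier lt (A j sb)) => dB.
    have : dfnR S (fun e : X -> M => B (fun v => match v with inl i => x i e | inr w => z w e end)).
      apply: (dfn_fam dB (x := fun v (e : option X -> M) =>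
        match v with inl i => x i (fun v => e (Some v)) | inr w => z w (fun v => e (Some v)) end)).
        by case=> v; exact: tm_wk.
      exact: dft_var.
    by [].
  have dR'' : dfn S (fun e : option X -> M =>
      R j (fun v => x v (fun v => e (Some v))) (fun w => z w (fun v => e (Some v))) (e None)) by [].
  rewrite /H; case: strict; apply: dfn_atleast => //; apply: dfn_and => //.
    apply: dfn_rel2 => //; [exact: dft_var|exact: dft_tm (tm_wk hy)].
  apply: dfn_not; apply: dfn_rel2 => //; [exact: dft_tm (tm_wk hy)|exact: dft_var].
have upH g s b t t' : lt t t' -> H g s t b -> H g s t' b.
  case: g => [[j i] []] tt'; [exact: atleast_cut_up|exact: atleast_ccut_up].
pose F' := fun B : set ('I_n -> M) => F (fun e => B (drop_at ord0 e)).
have UF' : ultra F' by exact: ultra_push.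
(* Each fiber of [Phi] contains or misses a whole cell, so meeting the cell is containing it; this
   is a condition on [s] alone. *)
pose hit (q : J * ('I_K * 'I_K)) s b := exists t,
  cell q.2.1 q.2.2 (R q.1 s b) t /\ Phi q.1 (insert ord0 s t) b.
pose J' : finType := (G + J * ('I_K * 'I_K))%type.
pose W' : finType := (W + W)%type.
(* Parameters are doubled because an inclusion compares two instances; [hit] reads the first
   copy. *)
pose Phi' (j : J') (s : 'I_n -> M) (b : W' -> M) := match j with
  | inl g => forall t, H g s t (fun w => b (inl w)) -> H g s t (fun w => b (inr w))
  | inr q => hit q s (fun w => b (inl w)) end.
have dcell (q : J * ('I_K * 'I_K)) : dfn S (fun e : option ('I_n + W') -> M =>
    cell q.2.1 q.2.2 (R q.1 (fun v => e (Some (inl v))) (fun w => e (Some (inr (inl w))))) (e None)).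
  case: q => [j [i i']] /=.
  have lK (k : 'I_K) : (k < K.+1)%N by exact: ltnW (ltn_ord k).
  have dHg g := @dH g (option ('I_n + W')) (fun v e => e (Some (inl v))) (fun e => e None)
    (fun w e => e (Some (inr (inl w)))) (fun v => tm_var S _) (tm_var S _) (fun v => tm_var S _).
  apply: dfn_and; apply: dfn_and; last 1 first.
  - by apply: dfn_not; exact: (dHg (j, Ordinal (ltn_ord i' : i'.+1 < K.+1)%N, false)).
  - exact: (dHg (j, Ordinal (lK i), true)).
  - by apply: dfn_not; exact: (dHg (j, Ordinal (ltn_ord i : i.+1 < K.+1)%N, true)).
  - exact: (dHg (j, Ordinal (lK i'), false)).
have [|Z' [Psi' [bPsi' dec]]] := IH F' W' J' Phi' UF'.
  case=> [g|q].
    apply: dfn_all; apply: dfn_imp.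
      exact: (dH g _ (fun v (e : option ('I_n + W') -> M) => e (Some (inl v))) (fun e => e None)
        (fun w e => e (Some (inr (inl w)))) (fun v => tm_var S _) (tm_var S _) (fun v => tm_var S _)).
    exact: (dH g _ (fun v (e : option ('I_n + W') -> M) => e (Some (inl v))) (fun e => e None)
      (fun w e => e (Some (inr (inr w)))) (fun v => tm_var S _) (tm_var S _) (fun v => tm_var S _)).
  apply: dfn_ex; apply: dfn_and; first exact: dcell.
  exact: (dfn_fam (dA q.1) (x := fun v (e : option ('I_n + W') -> M) =>
    match v with inl i => e (Some (inl i)) | inr w => e (Some (inr (inl w))) end)
    (fun v => match v with inl i => tm_var S _ | inr w => tm_var S _ end) (dft_var S _)).
have [||Z [Psi [bPsi hPsi]]] := @extend_base n F W G Z' H Psi' UF _ upH bPsi'.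
- move=> g; exact: (dH g _ (fun v (e : 'I_n.+1 + W -> M) => e (inl (lift ord0 v))) (fun e => e (inl ord0))
    (fun w e => e (inr w)) (fun v => tm_var S _) (tm_var S _) (fun v => tm_var S _)).
- by move=> g b b'; have := dec (inl g) (fun v => match v with inl w => b w | inr w => b' w end).
exists Z, Psi; split=> // j b.
(* The cells have finitely many codes, so the ultrafilter selects one. *)
have [q qK Fq] : exists2 q, q \in [seq (i, i') | i <- iota 0 K, i' <- iota 0 K] &
    F (fun e => cell q.1 q.2 (R j (drop_at ord0 e) b) (e ord0)).
  by apply: ultra_or_seq => //; apply: ultraS (ultraT UF) => // e _; exact: cell_exists.
case: q qK Fq => i0 i0' /allpairsP[[i i'] [/= + + [-> ->]]].
rewrite !mem_iota !add0n /= => iK i'K Fq {i0 i0'}.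
have [c' [Fc' hc']] := dec (inr (j, (Ordinal iK, Ordinal i'K)))
  (fun v => match v with inl w => b w | inr w => b w end).
have [c [Fc hc]] := hPsi b c' Fc'.
exists c; split=> //.
(* The four bounds defining the cell are instances of [H] at [b] or their negations; [F] settles
   each of them and [hc] makes [Psi] imply it. *)
have inC e : Psi e c -> Psi' (drop_at ord0 e) c' /\ cell i i' (R j (drop_at ord0 e) b) (e ord0).
  move=> /hc[Pc' k]; split=> //.
  pose g1 : G := (j, Ordinal (ltnW iK : i < K.+1)%N, true).
  pose g2 : G := (j, Ordinal (iK : i.+1 < K.+1)%N, true).
  pose g3 : G := (j, Ordinal (ltnW i'K : i' < K.+1)%N, false).
  pose g4 : G := (j, Ordinal (i'K : i'.+1 < K.+1)%N, false).
  split; split.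
  - by apply: (k g1).1; apply: ultraS Fq => // e' [[]].
  - by apply: (k g2).2 => Fg; apply: (ultra_incompat UF Fq Fg) => e' [[_ nh] _]; exact: nh.
  - by apply: (k g3).1; apply: ultraS Fq => // e' [_ []].
  - by apply: (k g4).2 => Fg; apply: (ultra_incompat UF Fq Fg) => e' [_ [_ nh]]; exact: nh.
have AE e t : A j (fun v => match v with inl i => drop_at ord0 e i | inr w => b w end) t =
    Phi j (insert ord0 (drop_at ord0 e) t) b by [].
case: hc' => hc'; [left|right] => e /inC[Pc' ce].
  have [t [ct Pt]] := hc' _ Pc'.
  rewrite -(upd_id e ord0) -insert_drop -AE.
  by apply/(cell_const (dfn_fiber _ (dA j)) ce ct); rewrite AE.
move=> Pe; apply: (hc' _ Pc'); exists (e ord0); split=> //=.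
by rewrite insert_drop upd_id.
Qed.

End UniformSubtypes.

(** * From complete types to ultrafilters *)

Section CompleteTypes.
Variables (L : signature) (d : Order.disp_t) (M : orderType d).
Variable S : structure L M.

(** The sets defined by members of [p] form a filter base, and completeness makes an ultrafilter
    above it agree with [p] on definable sets. *)
Lemma complete_type_ultra n (p : set (formula L M 'I_n)) : complete_type S p ->
  exists F, ultra F /\ forall chi, p chi <-> F (fun a => sat S chi a).
Proof.
move=> [con tot].
have con2 chi1 chi2 : p chi1 -> p chi2 -> exists a, sat S chi1 a /\ sat S chi2 a.
  move=> p1 p2; have [||a ha] := con [set chi1; chi2].
  - exact: finite_set2.
  - by move=> chi [->|->].
  by exists a; split; apply: ha; [left|right].
have contra chi : p chi -> ~ p (Neg chi).
  by move=> p1 /(con2 _ _ p1)[a []].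
have [|||F [UF hF]] := @ultra_exists _ _ p (fun chi a => sat S chi a).
- by have [h|h] := tot (Ex (Eq (Var None) (Var None))); eexists; exact: h.
- move=> chi1 chi2 p1 p2; exists (And chi1 chi2) => //.
  have [//|pn] := tot (And chi1 chi2); exfalso.
  have [||a ha] := con [set chi1; chi2; Neg (And chi1 chi2)].
  + by rewrite finite_setU; split; [exact: finite_set2|exact: finite_set1].
  + by move=> chi [[->|->]|->].
  have /= := ha (Neg (And chi1 chi2)) (or_intror erefl); apply.
  by split; apply: ha; left; [left|right].
- by move=> chi pc; have [a []] := con2 _ _ pc pc; exists a.
exists F; split=> // chi; split=> [/hF//|Fc].
have [//|/hF Fn] := tot chi.
by exfalso; apply: (ultra_incompat UF Fc Fn) => a h /(_ h).
Qed.

(** Directedness is applied once for each formula of the finite set, starting from any instance in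
    [F]. *)
Lemma finite_entails n (p : set (formula L M 'I_n)) (Z : Type)
    (Psi : ('I_n -> M) -> (Z -> M) -> Prop) (F : set (set ('I_n -> M))) :
  (exists c, F (fun a => Psi a c)) ->
  (forall c c', F (fun a => Psi a c) -> F (fun a => Psi a c') ->
    exists c'', F (fun a => Psi a c'') /\ forall a, Psi a c'' -> Psi a c /\ Psi a c') ->
  (forall chi, p chi -> exists c, F (fun a => Psi a c) /\
    forall a, Psi a c -> sat S chi a) ->
  finite_set p ->
  exists c, F (fun a => Psi a c) /\ forall chi a, p chi -> Psi a c -> sat S chi a.
Proof.
move=> [c0 Fc0] dir hp /(@finite_seqP {classic (formula L M 'I_n)})[s ps].
have {}ps chi : p chi -> (chi : {classic (formula L M 'I_n)}) \in s by rewrite ps.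
suff [c [Fc hc]] : exists c, F (fun a => Psi a c) /\
    forall chi a, (chi : {classic (formula L M 'I_n)}) \in s -> p chi ->
      Psi a c -> sat S chi a.
  by exists c; split=> // chi a pc; apply: hc => //; exact: ps.
elim: s {ps} => [|chi s [c [Fc IH]]]; first by exists c0.
have [pc|npc] := pselect (p chi); last first.
  exists c; split=> // chi' a; rewrite in_cons => /orP[/eqP->//|]; exact: IH.
have [c1 [Fc1 h1]] := hp chi pc; have [c2 [Fc2 h2]] := dir c c1 Fc Fc1.
exists c2; split=> // chi' a; rewrite in_cons => /orP[/eqP->|cs] pc' /h2[k1 k2].
  exact: h1.
exact: IH cs pc' k1.
Qed.

End CompleteTypes.

Theorem proposition4p1 (L : signature) (d : Order.disp_t) (M : orderType d)
    (S : structure L M) (hS : o_minimal S) (n m : nat)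
    (p : set (formula L M 'I_n)) (hp : complete_type S p)
    (phi : formula L M ('I_n + 'I_m)) :
  exists (k : nat) (psi : formula L M ('I_n + 'I_k)),
    [/\ downward_directed S (restr1 p psi),
        entails S (restr1 p psi) (restr p phi)
      & forall q : set (formula L M 'I_n),
          finite_set q -> q `<=` restr p phi ->
          exists c : 'I_k -> M,
            p (inst psi c) /\ entails S [set inst psi c] q].
Proof.
have O := o_minimal_order hS.
have [F [UF pF]] := complete_type_ultra hp.
have [|Z [Psi0 [[dPsi0 ne0 dir0] dec0]]] := @deciding_base _ _ _ S _ O n F 'I_m unit
  (fun _ a b => sat S phi (fun v => match v with inl i => a i | inr j => b j end)) UF.
  move=> _; exists phi => e; rewrite (_ : (fun v => _) = e) //.
  by apply: funext => -[].
(* The index type [Z] is enumerated, because parameter tuples of formulas are indexed by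
   ordinals. *)
have [f hf] : dfn S (fun e : 'I_n + 'I_#|Z| -> M =>
    Psi0 (fun v => e (inl v)) (fun z => e (inr (enum_rank z)))).
  apply: (dfnP_subst (x := fun v e => e (inl v)) (y := fun z e => e (inr (enum_rank z))) dPsi0) => v;
    exact: tm_var.
pose Psi a c := sat S (inst f c) a.
have PsiE a (c : 'I_#|Z| -> M) : Psi a c <-> Psi0 a (fun z => c (enum_rank z)).
  by rewrite /Psi sat_inst -hf.
have onto (c : Z -> M) : exists c', forall a, Psi a c' <-> Psi0 a c.
  exists (fun i => c (enum_val i)) => a; rewrite PsiE.
  by rewrite (_ : (fun z => _) = c) //; apply: funext => z; rewrite enum_rankK.
have FE (A B : set ('I_n -> M)) : (forall a, A a <-> B a) -> F A -> F B.
  by move=> AB; apply: (ultraS UF) => a /AB.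
have ne : exists c, F (fun a => Psi a c).
  by have [c Fc] := ne0; have [c' h] := onto c; exists c'; apply: FE Fc => a; rewrite h.
have dir c c' : F (fun a => Psi a c) -> F (fun a => Psi a c') ->
    exists c'', F (fun a => Psi a c'') /\ forall a, Psi a c'' -> Psi a c /\ Psi a c'.
  move=> /(FE _ _ (PsiE^~ c)) Fc /(FE _ _ (PsiE^~ c')) Fc'.
  have [c1 [Fc1 h1]] := dir0 _ _ Fc Fc'; have [c'' h] := onto c1.
  exists c''; split; first by apply: FE Fc1 => a; rewrite h.
  by move=> a; rewrite h => /h1; rewrite !PsiE.
have dec chi : restr p phi chi -> exists c, F (fun a => Psi a c) /\
    forall a, Psi a c -> sat S chi a.
  move=> [/pF Fchi [b chib]].
  have [c1 [Fc1 h1]] := dec0 tt b; have [c h] := onto c1.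
  have Fc : F (fun a => Psi a c) by apply: FE Fc1 => a; rewrite h.
  exists c; split=> // a; rewrite h => Pa.
  (* Of the two possible decisions, the one contradicting [chi] would put disjoint sets into [F]. *)
  case: chib => chiE; subst chi; case: h1 => h1.
  - by apply/sat_inst; exact: h1.
  - exfalso; apply: (ultra_incompat UF Fc1 Fchi) => a' /h1 k /sat_inst; exact: k.
  - by exfalso; apply: (ultra_incompat UF Fc1 Fchi) => a' /h1 k /=; rewrite sat_inst.
  - by rewrite /= sat_inst; exact: h1.
exists #|Z|, f; split.
- move=> chi1 chi2 [/pF F1 [c1 E1]] [/pF F2 [c2 E2]]; subst chi1 chi2.
  have [c [Fc hc]] := dir c1 c2 F1 F2; exists (inst f c); split.
  + by split; [exact/pF|exists c].
  + by move=> a /hc[].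
  + by move=> a /hc[].
- move=> chi /dec[c [Fc hc]]; exists [set inst f c]; split.
  + exact: finite_set1.
  + by move=> _ ->; split; [exact/pF|exists c].
  + by move=> a ha; apply: hc; exact: ha.
- move=> q fq qphi.
  have [c [Fc hc]] := finite_entails ne dir (fun chi qc => dec chi (qphi chi qc)) fq.
  exists c; split; first exact/pF.
  move=> chi qc; exists [set inst f c]; split=> // a ha.
  by apply: hc qc _; exact: ha.
Qed.
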